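(* Let $\mathcal H$ be a complex Hilbert space and let $M_A, M_B \subset B(\mathcal H)$ be a pair of commuting von Neumann algebras on $\mathcal H$ (i.e. $ab=ba$ for all $a\in M_A$, $b\in M_B$). Then the pair $(M_A,M_B)$ has the Uhlmann property if and only if Haag duality $M_B = M_A'$ holds. Moreover, in this case, whenever $\Psi,\Phi\in\mathcal H$ are unit vectors with the same $A$-marginal, i.e. $\langle \Psi, a\Psi\rangle = \langle \Phi, a\Phi\rangle$ for all $a\in M_A$, there exists a partial isometry $v\in M_B$ with $v\Psi=\Phi$.
   Context: A von Neumann algebra on $\mathcal H$ is a unital *-subalgebra $M\subset B(\mathcal H)$ (containing the identity operator of $\mathcal H$) with $M=M''$, where $M' = \{x\in B(\mathcal H) : xy=yx \ \forall y\in M\}$ denotes the commutant. Uhlmann property: a pair of commuting von Neumann algebras $M_A,M_B$ on $\mathcal H$ has the Uhlmann property if, for any two unit vectors $\Phi,\Psi\in\mathcal H$, the condition $\langle \Psi,a\Psi\rangle=\langle\Phi,a\Phi\rangle$ for all $a\in M_A$ implies that for every $\varepsilon>0$ there exists a unitary $u\in M_B$ with $|\langle\Psi,u\Phi\rangle|\ge 1-\varepsilon$. Haag duality: the pair $(M_A,M_B)$ satisfies Haag duality if $M_B=M_A'$ (equivalently, $M_A=M_B'$). *)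

(* Defs.v *)
From HB Require Import structures.
From mathcomp Require Import all_boot all_order all_algebra complex.
From mathcomp Require Import boolp classical_sets functions reals.
From mathcomp Require Import topology normedtype.

Set Implicit Arguments.
Unset Strict Implicit.
Unset Printing Implicit Defensive.
Import Order.TTheory GRing.Theory Num.Theory Num.Def.
Import numFieldNormedType.Exports.

Local Open Scope classical_set_scope.
Local Open Scope complex_scope.
Local Open Scope ring_scope.

(* The norm of a normed module over R[i] takes its values in R[i]. *)
HB.mixin Record CompleteNormedModule_isHilbert (R : realType) H
    of CompleteNormedModule R[i] H := {
  hdot : {dot H for conjC} ;
  hnormE : forall x : H, `|x| ^+ 2 = hdot x x
}.

#[short(type="hilbertType")]
HB.structure Definition Hilbert (R : realType) :=
  {H of CompleteNormedModule R[i] H & CompleteNormedModule_isHilbert R H}.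

(* The forms {dot _ for conjC} are linear in the first variable; the inner
   product used here is linear in the second one. *)
Definition inner (R : realType) (H : hilbertType R) (x y : H) : R[i] :=
  hdot y x.

Section Operators.
Variables (R : realType) (H : hilbertType R).
Implicit Types (a b u v : H -> H) (M : set (H -> H)).

Definition bounded_op : set (H -> H) :=
  [set a | linear a /\ exists C : R, forall x, `|a x| <= C%:C * `|x|].

(* [adjoint a b] means b = a^*: at most one b satisfies it, and for a bounded
   operator there is one, by the Riesz representation theorem. *)
Definition adjoint a b : Prop :=
  forall x y : H, inner x (a y) = inner (b x) y.

Definition unitary_op u : Prop :=
  bounded_op u /\
  exists2 w, adjoint u w & w \o u = idfun /\ u \o w = idfun.

Definition partial_isometry v : Prop :=
  bounded_op v /\ exists2 w, adjoint v w & v \o w \o v = v.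

Definition commutant M : set (H -> H) :=
  [set x | bounded_op x /\ forall y, M y -> x \o y = y \o x].

Record von_neumann_algebra M : Prop := VonNeumannAlgebra {
  vna_bounded : M `<=` bounded_op ;
  vna_id : M idfun ;
  vna_add : forall a b, M a -> M b -> M (a \+ b) ;
  vna_scale : forall (k : R[i]) a, M a -> M (k \*: a) ;
  vna_comp : forall a b, M a -> M b -> M (a \o b) ;
  vna_adjoint : forall a, M a -> exists2 b, adjoint a b & M b ;
  vna_bicommutant : M = commutant (commutant M)
}.

Definition commuting (MA MB : set (H -> H)) : Prop :=
  forall a b, MA a -> MB b -> a \o b = b \o a.

Definition same_marginal M (Psi Phi : H) : Prop :=
  forall a, M a -> inner Psi (a Psi) = inner Phi (a Phi).

Definition uhlmann_property (MA MB : set (H -> H)) : Prop :=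
  forall Phi Psi : H, `|Phi| = 1 -> `|Psi| = 1 ->
    same_marginal MA Psi Phi ->
    forall e : R, 0 < e ->
    exists u, [/\ MB u, unitary_op u & 1 - e%:C <= `|inner Psi (u Phi)|].

Definition haag_duality (MA MB : set (H -> H)) : Prop := MB = commutant MA.

End Operators.

(* Main.v *)
Require Import Defs.
From mathcomp Require Import all_boot all_order all_algebra complex.
From mathcomp Require Import boolp classical_sets functions reals.
From mathcomp Require Import topology normedtype.
From mathcomp Require Import ring lra.
Import Order.TTheory GRing.Theory Num.Theory.
Import numFieldNormedType.Exports.
Local Open Scope classical_set_scope.
Local Open Scope ring_scope.

(** From Haag duality to partial isometries: two vectors with equal marginals on
    [MA] give an isometry [a Psi |-> a Phi] of [MA Psi] onto [MA Phi] that
    commutes with [MA]; its closure, extended by 0, is a partial isometry of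
    [commutant MA].

    From Haag duality to the Uhlmann property: let [v] be a contraction of
    [commutant MA] with [v Phi = Psi], and let [1] almost maximise
    [Re <Psi, u Phi>] over the unitaries [u] of [commutant MA] (a near-maximiser
    is absorbed into [Phi]). A selfadjoint contraction [c] is the mean of the
    unitaries [c +- i sqrt (1 - c^2)], so the functional [F x = <Psi, x Phi>] is
    almost positive; perturbing [1] by [i t k] shows that it is almost hermitian.
    Writing [v = h + i k] gives [F h] almost at least 1, and
    [F ((1 - h)^2) >= 0] up to a small error then forces [F 1] close to 1.

    From the Uhlmann property to Haag duality: a unitary [u] of [commutant MA]
    does not change marginals, so [u Psi] lies in the closure of [MB Psi]. Hence
    every [x] in [commutant MA] preserves the closed [MB]-invariant subspaces,
    that is, it commutes with the projections of [commutant MB]. For [y]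
    selfadjoint in [commutant MB], bisecting the numerical range of [y] with such
    projections makes the commutator of [x] and [y] arbitrarily small, so [x] is
    in the bicommutant of [MB]. *)

(** * Real inner product and norm of a complex Hilbert space *)

Section RealInnerProduct.
Context {R : realType} {H : hilbertType R}.
Implicit Types (x y z : H) (r : R).

(** The norm of [H] takes values in [R[i]]; its real part allows estimates in the ordered field
    [R]. *)
Definition nm x : R := complex.Re `|x|.

Definition rip x y : R := complex.Re (inner x y).

Lemma normE x : `|x| = (nm x)%:C%C.
Proof. by rewrite /nm RRe_real // ger0_real. Qed.

Lemma nm_ge0 x : 0 <= nm x.
Proof. by have := normr_ge0 x; rewrite normE ler0c. Qed.

Lemma innerC x y : inner x y = ((inner y x)^*)%C.
Proof.
by rewrite /inner hermC /= expr0 mul1r.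
Qed.

Lemma ripC x y : rip x y = rip y x.
Proof. by rewrite /rip innerC; case: (inner y x). Qed.

Lemma innerDr x y z : inner x (y + z) = inner x y + inner x z.
Proof. exact: linearDl. Qed.

Lemma innerZr x (k : R[i]) y : inner x (k *: y) = k * inner x y.
Proof. exact: linearZl_LR. Qed.

Lemma ripDr x y z : rip x (y + z) = rip x y + rip x z.
Proof. by rewrite /rip innerDr; case: (inner x y); case: (inner x z). Qed.

Lemma ripDl x y z : rip (x + y) z = rip x z + rip y z.
Proof. by rewrite ripC ripDr !(ripC z). Qed.

Lemma ripZr x r y : rip x (r%:C%C *: y) = r * rip x y.
Proof. by rewrite /rip innerZr; case: (inner x y) => a b /=; rewrite mul0r subr0. Qed.

Lemma ripZl x r y : rip (r%:C%C *: x) y = r * rip x y.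
Proof. by rewrite ripC ripZr ripC. Qed.

Lemma ripNr x y : rip x (- y) = - rip x y.
Proof. by rewrite -scaleN1r -[-1](rmorphN1 (real_complex R)) ripZr mulN1r. Qed.

Lemma ripNl x y : rip (- x) y = - rip x y.
Proof. by rewrite ripC ripNr ripC. Qed.

Lemma rip0r x : rip x 0 = 0.
Proof. by rewrite -(scale0r x) -[0](rmorph0 (real_complex R)) ripZr mul0r. Qed.

Lemma rip0l x : rip 0 x = 0.
Proof. by rewrite ripC rip0r. Qed.

Definition ripE := (ripDl, ripDr, ripNl, ripNr, ripZl, ripZr, rip0l, rip0r).

(** The imaginary part is read off by multiplying the second argument by ['i], so every complex
    identity reduces to two identities for [rip]. *)
Lemma innerE x y : inner x y = (rip x y +i* (- rip x ('i *: y)))%C.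
Proof.
rewrite /rip innerZr; case: (inner x y) => a b /=.
by rewrite mul0r mul1r sub0r opprK.
Qed.

Lemma rip_iN x y : rip ('i *: x)%C y = - rip x ('i *: y)%C.
Proof.
rewrite /rip innerC !innerZr (innerC x y); case: (inner y x) => a b /=.
by rewrite !mul0r !mul1r !sub0r opprK.
Qed.

Lemma scale_ii x : ('i *: ('i *: x))%C = - x.
Proof. by rewrite scalerA -expr2 sqr_i scaleN1r. Qed.

Lemma scaleE (k : R[i]) x :
  k *: x = (complex.Re k)%:C%C *: x + (complex.Im k)%:C%C *: ('i *: x)%C.
Proof. by rewrite scalerA -scalerDl mulrC -complexE. Qed.

Lemma rip_nm x : rip x x = nm x ^+ 2.
Proof.
rewrite /rip /inner -hnormE normE /=.
by rewrite expr2 /= mul0r subr0.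
Qed.

Lemma rip_ge0 x : 0 <= rip x x.
Proof. by rewrite rip_nm sqr_ge0. Qed.

Lemma nm_eq0 x : nm x = 0 -> x = 0.
Proof. by move=> x0; apply/normr0_eq0; rewrite normE x0. Qed.

Lemma nm0 : nm 0 = 0.
Proof. by rewrite /nm normr0. Qed.

Lemma rip_eq0 x : rip x x = 0 -> x = 0.
Proof. by rewrite rip_nm => /eqP; rewrite sqrf_eq0 => /eqP /nm_eq0. Qed.

Lemma vecP x y : (forall z, rip x z = rip y z) -> x = y.
Proof.
move=> xy; apply/subr0_eq/rip_eq0.
by rewrite ripDl ripNl xy subrr.
Qed.

Lemma nm_triangle x y : nm (x + y) <= nm x + nm y.
Proof. by have := ler_normD x y; rewrite !normE -rmorphD lecR. Qed.

Lemma nmN x : nm (- x) = nm x.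
Proof. by rewrite /nm normrN. Qed.

Lemma nmB x y : nm (x - y) = nm (y - x).
Proof. by rewrite -nmN opprB. Qed.

Lemma nmZ r x : nm (r%:C%C *: x) = `|r| * nm x.
Proof.
apply/eqP; rewrite -(@eqrXn2 _ 2) ?mulr_ge0 ?nm_ge0//.
by rewrite exprMn -!rip_nm !ripE real_normK ?num_real// expr2 mulrA.
Qed.

Lemma nm_i x : nm ('i *: x)%C = nm x.
Proof.
apply/eqP; rewrite -(@eqrXn2 _ 2) ?nm_ge0//.
by rewrite -!rip_nm rip_iN scale_ii ripNr opprK.
Qed.

(** Cauchy-Schwarz, by expanding the square norm of [nm y *: x - nm x *: y]. *)
Lemma rip_le x y : rip x y <= nm x * nm y.
Proof.
have [->|x0] := eqVneq x 0; first by rewrite rip0l nm0 mul0r.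
have [->|y0] := eqVneq y 0; first by rewrite rip0r nm0 mulr0.
have xp : 0 < nm x.
  by rewrite lt_def nm_ge0 andbT; apply: contra_neq x0; apply: nm_eq0.
have yp : 0 < nm y.
  by rewrite lt_def nm_ge0 andbT; apply: contra_neq y0; apply: nm_eq0.
have := rip_ge0 ((nm y)%:C%C *: x - (nm x)%:C%C *: y).
rewrite !ripE (ripC y x) !rip_nm => le0.
have : 0 <= (2 * nm x * nm y) * (nm x * nm y - rip x y) by nra.
by rewrite pmulr_rge0 ?subr_ge0// !mulr_gt0.
Qed.

Lemma rip_abs_le x y : `|rip x y| <= nm x * nm y.
Proof.
rewrite ler_norml rip_le andbT -lerNl -ripNl.
by rewrite (le_trans (rip_le _ _))// nmN.
Qed.

Lemma nm_complete (u : nat -> H) :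
  (forall e, 0 < e -> exists N, forall n m,
      (N <= n)%N -> (N <= m)%N -> nm (u n - u m) < e) ->
  exists l, forall e, 0 < e -> exists N, forall n, (N <= n)%N -> nm (l - u n) < e.
Proof.
move=> cu.
have : cauchy (u @ \oo).
  (* The order of [R[i]] forces a positive [e] to be real, so real radii suffice. *)
  apply: cauchy_exP => e; rewrite ltcE /= => /andP[/eqP ie re].
  have [N uN] := cu _ re.
  exists (u N); exists N => // n /= Nn; rewrite -ball_normE /=.
  by rewrite normE ltcE /= ie eqxx /=; apply: uN.
move=> /cauchy_cvg /cvg_ex [l /cvgrPdist_lt ul]; exists l => e e0.
have /ul [N _ uN] : 0 < e%:C%C by rewrite ltcR.
by exists N => n Nn; have := uN n Nn; rewrite normE ltcR.
Qed.

End RealInnerProduct.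

(** * Elementary properties of linear maps *)

Section LinearMaps.
Context {R : realType} {H : hilbertType R} {a : H -> H}.
Context (al : linear a).

Lemma linD x y : a (x + y) = a x + a y.
Proof. by have := al 1 x y; rewrite !scale1r. Qed.

Lemma lin0 : a 0 = 0.
Proof. by apply: (addIr (a 0)); rewrite -linD !add0r. Qed.

Lemma linZ k x : a (k *: x) = k *: a x.
Proof. by have := al k x 0; rewrite lin0 !addr0. Qed.

Lemma linN x : a (- x) = - a x.
Proof. by rewrite -scaleN1r linZ scaleN1r. Qed.

Lemma linB x y : a (x - y) = a x - a y.
Proof. by rewrite linD linN. Qed.

End LinearMaps.

(** * Minimisation and the Riesz representation *)

Section Riesz.
Context {R : realType} {H : hilbertType R}.

(** The restriction [e <= 1] allows error terms in [e ^+ 2] to be absorbed into a multiple of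
    [e]. *)
Lemma le0_eps (x K : R) :
  0 <= K -> (forall e, 0 < e -> e <= 1 -> x <= e * K) -> x <= 0.
Proof.
move=> K0 h; rewrite leNgt; apply/negP => x0.
pose e := Num.min 1 (x / (2 * (K + 1))).
have K1 : 0 < 2 * (K + 1) by lra.
have e0 : 0 < e by rewrite lt_min ltr01 divr_gt0.
have e1 : e <= 1 by rewrite ge_min lexx.
have e2 : e * (2 * (K + 1)) <= x by rewrite -ler_pdivlMr// ge_min lexx orbT.
by have := h e e0 e1; nra.
Qed.

Lemma bounded_opP (a : H -> H) :
  bounded_op a <->
  linear a /\ exists2 C, 0 <= C & forall x, nm (a x) <= C * nm x.
Proof.
split=> [[al [C aC]]|[al [C _ aC]]]; split=> //.
  exists `|C| => // x; have := aC x; rewrite !normE -rmorphM lecR => h.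
  by rewrite (le_trans h)// ler_wpM2r ?nm_ge0 ?ler_norm.
by exists C => x; rewrite !normE -rmorphM lecR.
Qed.

(* The vector [l] minimises the quadratic functional
   [|q|^2 - 2 <xi, p>] over the closure of the relation [G]. *)
Lemma riesz (G : H -> H -> Prop) (C : R) (xi : H) :
  0 <= C -> G 0 0 ->
  (forall p q p' q' r, G p q -> G p' q' ->
     G (r%:C%C *: p + p') (r%:C%C *: q + q')) ->
  (forall p q, G p q -> nm p <= C * nm q) ->
  exists l, [/\ forall p q, G p q -> rip l q = rip xi p,
    forall z, (forall p q, G p q -> rip z q = 0) -> rip z l = 0 &
    nm l <= C * nm xi].
Proof.
move=> C0 G0 Glin GC.
pose J (p q : H) := nm q ^+ 2 - 2 * rip xi p.
(* The supremum is taken of [- J], so that [- m] below is the infimum of [J]. *)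
pose S : set R := [set x | exists p q, G p q /\ x = - J p q].
have Sub x : S x -> x <= (C * nm xi) ^+ 2.
  move=> [p [q [Gpq ->]]]; rewrite /J.
  have := rip_le xi p; have := GC _ _ Gpq; have := nm_ge0 xi => x0 pq xp.
  have : nm xi * nm p <= nm xi * (C * nm q) by rewrite ler_wpM2l.
  have := sqr_ge0 (C * nm xi - nm q); nra.
have Ssup : has_sup S.
  by split; [exists (- J 0 0), 0, 0|exists ((C * nm xi) ^+ 2)].
pose m := sup S.
have Jm p q : G p q -> - m <= J p q.
  move=> Gpq; rewrite lerNl; apply: ub_le_sup; first by case: Ssup.
  by exists p, q.
have app n : exists pq, G pq.1 pq.2 /\ J pq.1 pq.2 < - m + n.+1%:R^-1.
  have [_ [p [q [Gpq ->]]] h] := @sup_adherent _ S n.+1%:R^-1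
    ltac:(by rewrite invr_gt0 ltr0n) Ssup.
  by exists (p, q); split=> //; rewrite -ltrN2 opprD opprK.
have [u uP] := choice app.
have dist p q p' q' d : G p q -> G p' q' -> J p q < - m + d -> J p' q' < - m + d ->
    nm (q - q') ^+ 2 < 4 * d.
  move=> Gp Gp' Jp Jp'.
  (* Parallelogram law at the midpoint. The coefficient [2^-1-1] yields half of [q'], since [Glin]
     adds an unscaled copy. *)
  have := Jm _ _ (Glin _ _ _ _ 2^-1 Gp (Glin _ _ _ _ (2^-1-1) Gp' Gp')).
  move: Jp Jp'; rewrite /J -!rip_nm !ripE (ripC q' q); nra.
have invlt (e : R) : 0 < e -> exists N, forall n, (N <= n)%N -> n.+1%:R^-1 < e.
  move=> e0; exists (Num.bound e^-1) => n Nn.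
  have ei : 0 <= e^-1 by rewrite invr_ge0 ltW.
  rewrite invf_plt ?posrE// (lt_le_trans (archi_boundP ei))//.
  by rewrite ler_nat (leq_trans Nn).
have [] := @nm_complete R H (fun n => (u n).2).
  move=> e e0.
  have [N NP] := invlt (e ^+ 2 / 4) ltac:(by rewrite divr_gt0 ?exprn_gt0).
  exists N => n k Nn Nk.
  have [Gn Jn] := uP n; have [Gk Jk] := uP k.
  have := dist _ _ _ _ _ Gn Gk (lt_trans Jn _) (lt_trans Jk _).
  move=> /(_ (e ^+ 2 / 4)).
  rewrite !ltrD2l !NP// => /(_ isT isT) h.
  rewrite -(@ltr_pXn2r _ 2)// ?nnegrE ?nm_ge0 ?ltW//.
  by rewrite (lt_le_trans h)//; lra.
move=> l lP.
have near (e : R) : 0 < e ->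
    exists p q, [/\ G p q, nm (l - q) < e & J p q < - m + e].
  move=> e0; have [N NP] := invlt _ e0; have [M MP] := lP _ e0.
  have [Gn Jn] := uP (maxn N M).
  exists (u (maxn N M)).1, (u (maxn N M)).2; split=> //.
    by apply: MP; rewrite leq_maxr.
  by rewrite (lt_trans Jn)// ltrD2l NP// leq_maxl.
have lim p q : G p q -> rip l q = rip xi p.
  move=> Gpq.
  suff : (rip l q - rip xi p) ^+ 2 <= 0.
    by rewrite le_eqVlt ltNge sqr_ge0 orbF sqrf_eq0 => /eqP/subr0_eq.
  set D := rip l q - rip xi p.
  apply: (le0_eps _ (2 * `|D| * nm q + nm q ^+ 2 + nm q ^+ 2)) => [|e e0 e1].
    by rewrite !addr_ge0 ?sqr_ge0 ?mulr_ge0 ?nm_ge0.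
  have [p' [q' [Gpq' lq Je]]] := near _ e0.
  pose D' := rip q' q - rip xi p.
  (* Comparing [J] at [t q + q'] with its infimum makes a quadratic polynomial in [t] nonnegative;
     its discriminant then bounds [D' ^+ 2]. *)
  have D'P t : 0 <= e + 2 * t * D' + t ^+ 2 * nm q ^+ 2.
    have := Jm _ _ (Glin _ _ _ _ t Gpq Gpq').
    by move: Je; rewrite /J /D' -!rip_nm !ripE (ripC q' q); nra.
  have D'2 : D' ^+ 2 <= e * nm q ^+ 2.
    have [q0|q0] := eqVneq (nm q) 0.
      have [D0|D0] := eqVneq D' 0; first by rewrite D0 q0; lra.
      have := D'P (- e / D'); rewrite q0.
      by rewrite -mulrA mulfVK//; lra.
    have q2 : 0 < nm q ^+ 2 by rewrite exprn_even_gt0.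
    have := D'P (- D' / nm q ^+ 2).
    set s := nm q ^+ 2 in q2 *.
    have -> : e + 2 * (- D' / s) * D' + (- D' / s) ^+ 2 * s = (e * s - D' ^+ 2) / s.
      by field; rewrite gt_eqF.
    by rewrite pmulr_lge0 ?invr_gt0// subr_ge0.
  have DD : `|D - D'| <= e * nm q.
    have -> : D - D' = rip (l - q') q by rewrite ripDl ripNl /D /D'; ring.
    by rewrite (le_trans (rip_abs_le _ _))// ler_wpM2r ?nm_ge0// ltW.
  have -> : D ^+ 2 = 2 * D * (D - D') - (D - D') ^+ 2 + D' ^+ 2 by ring.
  have := ler_norm (D * (D - D')); rewrite normrM => h1.
  have h2 : `|D| * `|D - D'| <= `|D| * (e * nm q) by rewrite ler_wpM2l.
  have h3 := sqr_ge0 (D - D'); have h4 : 0 <= e * nm q ^+ 2.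
    by rewrite mulr_ge0 ?sqr_ge0 ?ltW.
  nra.
exists l; split=> // [z zP|].
  apply/eqP; rewrite -normr_le0; apply: (le0_eps _ (nm z)); first exact: nm_ge0.
  move=> e e0 e1.
  have [p' [q' [Gpq' lq Je]]] := near _ e0.
  have -> : rip z l = rip z (l - q') by rewrite ripDr ripNr (zP _ _ Gpq') subr0.
  by rewrite (le_trans (rip_abs_le _ _))// mulrC ler_wpM2r ?nm_ge0// ltW.
(* Pairing [l] with an approximant [q'] and using [rip l q' = rip xi p'] gives this bound up to
   [e]. *)
suff : nm l ^+ 2 - C * nm xi * nm l <= 0.
  have [->|l0] := eqVneq (nm l) 0; first by rewrite mulr_ge0 ?nm_ge0.
  by rewrite subr_le0 expr2 ler_pM2r// lt_def l0 nm_ge0.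
apply: (le0_eps _ (nm l + C * nm xi)).
  by rewrite addr_ge0 ?mulr_ge0 ?nm_ge0.
move=> e e0 e1; have [p' [q' [Gpq' lq Je]]] := near _ e0.
have h1 : nm l ^+ 2 = rip l (l - q') + rip l q' by rewrite -ripDr subrK rip_nm.
have h2 : rip l (l - q') <= nm l * e.
  by rewrite (le_trans (rip_le _ _))// ler_wpM2l ?nm_ge0// ltW.
have h3 : rip l q' <= nm xi * (C * (nm l + e)).
  rewrite (lim _ _ Gpq') (le_trans (rip_le _ _))// ler_wpM2l ?nm_ge0//.
  rewrite (le_trans (GC _ _ Gpq'))// ler_wpM2l//.
  have -> : q' = l - (l - q') by rewrite opprB addrC subrK.
  by rewrite (le_trans (nm_triangle _ _))// lerD2l nmN ltW.
by nra.
Qed.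

End Riesz.

(** * Adjoints and bounded operators *)

Section Operators.
Context {R : realType} {H : hilbertType R}.
Implicit Types (a b : H -> H) (x y z : H).

Lemma inner_eqP x y x' y' :
  rip x y = rip x' y' -> rip x ('i *: y)%C = rip x' ('i *: y')%C ->
  inner x y = inner x' y'.
Proof. by move=> e1 e2; rewrite !innerE e1 e2. Qed.

Lemma innerBr x y z : inner x (y - z) = inner x y - inner x z.
Proof. by rewrite innerDr -scaleN1r innerZr mulN1r. Qed.

Lemma innerDl x y z : inner (x + y) z = inner x z + inner y z.
Proof. exact: linearDr. Qed.

Lemma innerBl x y z : inner (x - y) z = inner x z - inner y z.
Proof. exact: linearBr. Qed.

Lemma inner_eq0C x y : inner x y = 0 -> inner y x = 0.
Proof. by rewrite innerC => /(congr1 conjc); rewrite conjcK conjc0. Qed.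

Lemma inner0r x : inner x 0 = 0.
Proof. by rewrite innerE !scaler0 rip0r oppr0. Qed.

Lemma inner_eqC x y z t : inner x y = inner z t -> inner y x = inner t z.
Proof. by move=> e; rewrite innerC e -innerC. Qed.

Lemma innerxx_eq0 x : inner x x = 0 -> x = 0.
Proof. by move=> e; apply: rip_eq0; rewrite /rip e. Qed.

Lemma inner_inj x y : (forall z, inner z x = inner z y) -> x = y.
Proof.
by move=> xy; apply/subr0_eq/innerxx_eq0; rewrite innerBr xy subrr.
Qed.

Lemma adjointP a b : linear a -> linear b ->
  adjoint a b <-> forall x y, rip x (a y) = rip (b x) y.
Proof.
move=> al bl; split=> [ab x y|ab x y]; first by rewrite /rip ab.
by apply: inner_eqP; rewrite ?ab// -(linZ al) ab.
Qed.

Lemma adjoint_sym a b : adjoint a b -> adjoint b a.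
Proof. by move=> ab x y; apply: inner_eqC; rewrite ab. Qed.

Lemma adjoint_uniq a b c : adjoint a b -> adjoint a c -> b = c.
Proof.
move=> ab ac; apply/funext => x; apply: inner_inj => z.
by apply: inner_eqC; rewrite -ab -ac.
Qed.

(* The adjoint of the possibly only partially defined operator [q |-> p]
   with graph [G], extended by taking values in the closed range of [G]. *)
Lemma relation_adjoint (G : H -> H -> Prop) (C : R) :
  0 <= C -> G 0 0 ->
  (forall p q p' q' (k : R[i]), G p q -> G p' q' ->
     G (k *: p + p') (k *: q + q')) ->
  (forall p q, G p q -> nm p <= C * nm q) ->
  exists v, [/\ linear v, forall x, nm (v x) <= C * nm x,
    forall x p q, G p q -> inner q (v x) = inner p x &
    forall x z, (forall p q, G p q -> inner z q = 0) -> inner z (v x) = 0].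
Proof.
move=> C0 G0 Glin GC.
have GZ k p q : G p q -> G (k *: p) (k *: q).
  by move=> Gpq; have := Glin _ _ _ _ k Gpq G0; rewrite !addr0.
have [v vP] := choice (fun x => riesz G C x C0 G0
  (fun p q p' q' r => Glin p q p' q' r%:C%C) GC).
have v1 x p q : G p q -> inner q (v x) = inner p x.
  have [vG _ _] := vP x; move=> Gpq; apply: inner_eqC.
  by apply: inner_eqP; apply: vG => //; exact: GZ.
have v2 x z : (forall p q, G p q -> inner z q = 0) -> inner z (v x) = 0.
  have [_ vG _] := vP x; move=> zG.
  have e w : (forall p q, G p q -> inner w q = 0) -> rip w (v x) = 0.
    by move=> wG; apply: vG => p q /wG; rewrite /rip => ->.
  rewrite innerE e// -rip_iN e// => p q Gpq.
  by apply: inner_eq0C; rewrite innerZr (inner_eq0C _ _ (zG _ _ Gpq)) mulr0.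
exists v; split=> //; last by move=> x; case: (vP x).
(* The defect of linearity [d] is orthogonal to every [q], hence by [v2] to all values of [v], and
   so to itself. *)
move=> k x y; apply/subr0_eq/innerxx_eq0; set d := v _ - _.
have dq p q : G p q -> inner d q = 0.
  move=> Gpq; apply: inner_eq0C.
  by rewrite innerBr innerDr innerZr !(v1 _ _ _ Gpq) innerDr innerZr subrr.
by rewrite {2}/d innerBr innerDr innerZr !v2// mulr0 addr0 subrr.
Qed.

(** The graph of [a], where [q] runs over all of [H], is a special case of [relation_adjoint]. *)
Lemma adjoint_ex a : bounded_op a -> exists2 b, adjoint a b & bounded_op b.
Proof.
move=> /bounded_opP [al [C C0 aC]].
have [||p q p' q' k -> ->|p q ->//|v [vl vC va _]] :=
  @relation_adjoint (fun p q => p = a q) C => //.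
- by rewrite lin0.
- by rewrite al.
exists v; last by apply/bounded_opP; split=> //; exists C.
by move=> x y; apply: inner_eqC; rewrite (va x (a y)).
Qed.

Lemma bounded_id : bounded_op (idfun : H -> H).
Proof. by apply/bounded_opP; split=> //; exists 1 => // x; rewrite mul1r. Qed.

Lemma bounded_add a b : bounded_op a -> bounded_op b -> bounded_op (a \+ b).
Proof.
move=> /bounded_opP[al [C C0 aC]] /bounded_opP[bl [D D0 bD]].
apply/bounded_opP; split=> [k x y /=|]; first by rewrite al bl scalerDr addrACA.
exists (C + D); first exact: addr_ge0.
by move=> x; rewrite (le_trans (nm_triangle _ _))// mulrDl lerD.
Qed.

Lemma nmZc (k : R[i]) x : nm (k *: x) = complex.Re `|k| * nm x.
Proof.
rewrite {1}/nm normrZ normE; have := normr_ge0 k; rewrite lecE /= => /andP[/eqP].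
by case: (`|k|) => k1 k2 /= -> _; rewrite mul0r subr0.
Qed.

Lemma Re_norm_ge0 (k : R[i]) : 0 <= complex.Re `|k|.
Proof. by have := normr_ge0 k; rewrite lecE => /andP[]. Qed.

Lemma bounded_scale (k : R[i]) a : bounded_op a -> bounded_op (k \*: a).
Proof.
move=> /bounded_opP[al [C C0 aC]].
apply/bounded_opP; split=> [l x y /=|].
  by rewrite al scalerDr !scalerA mulrC.
exists (complex.Re `|k| * C); first by rewrite mulr_ge0 ?Re_norm_ge0.
by move=> x /=; rewrite nmZc -mulrA ler_wpM2l ?Re_norm_ge0.
Qed.

Lemma bounded_comp a b : bounded_op a -> bounded_op b -> bounded_op (a \o b).
Proof.
move=> /bounded_opP[al [C C0 aC]] /bounded_opP[bl [D D0 bD]].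
apply/bounded_opP; split=> [k x y /=|]; first by rewrite bl al.
exists (C * D); first exact: mulr_ge0.
by move=> x; rewrite (le_trans (aC _))// -mulrA ler_wpM2l.
Qed.

Lemma adjoint_add a b c d :
  adjoint a b -> adjoint c d -> adjoint (a \+ c) (b \+ d).
Proof.
by move=> ab cd x y; rewrite /= innerDr ab cd innerDl.
Qed.

Lemma adjoint_scale (k : R[i]) a b :
  adjoint a b -> adjoint (k \*: a) ((k^*)%C \*: b).
Proof.
move=> ab x y /=; rewrite innerZr ab innerC (innerC (_ *: _)) innerZr.
by rewrite rmorphM /= conjcK.
Qed.

Lemma adjoint_comp a b c d :
  adjoint a b -> adjoint c d -> adjoint (a \o c) (d \o b).
Proof. by move=> ab cd x y /=; rewrite ab cd. Qed.

End Operators.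

(** * Kernel projections and square roots of selfadjoint operators *)

Section SelfAdjoint.
Context {R : realType} {H : hilbertType R}.
Implicit Types (a b : H -> H) (x y z : H).

Definition selfadjoint a := bounded_op a /\ adjoint a a.

Definition projection a := selfadjoint a /\ forall x, a (a x) = a x.

Lemma rip_sa a x y : adjoint a a -> rip x (a y) = rip (a x) y.
Proof. by move=> aa; rewrite /rip aa. Qed.

(** The adjoint of the identity restricted to the kernel of [s] is the orthogonal projection onto
    that kernel. If [b] commutes with [s], the adjoint of [b] also preserves the kernel because [s]
    is selfadjoint; this makes [b] commute with [N]. *)
Lemma kernel_projection s : selfadjoint s ->
  exists2 N, projection N & (forall x, N x = x <-> s x = 0) /\
    (forall b, bounded_op b -> (forall x, b (s x) = s (b x)) ->
       forall x, b (N x) = N (b x)).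
Proof.
move=> [/[dup] sb [sl _] ss].
pose G p q : Prop := p = q /\ s q = 0.
have [|p q p' q' k [<- sp] [<- sp']|p q [-> _]|N [Nl Nn NG NK]] :=
    @relation_adjoint R H G 1 ler01.
- by rewrite /G (lin0 sl).
- by split=> //; rewrite sl sp sp' scaler0 addr0.
- by rewrite mul1r.
have Nb : bounded_op N by apply/bounded_opP; split=> //; exists 1.
have Nin x q : s q = 0 -> inner q (N x) = inner q x by move=> sq; apply: NG.
have Nk x : s (N x) = 0.
  apply: inner_inj => y; rewrite ss NK => [|p q [_ sq]]; last first.
    by rewrite -ss sq inner0r.
  by rewrite inner0r.
have s_eq x y : s x = 0 -> s y = 0 ->
    (forall z, s z = 0 -> inner z x = inner z y) -> x = y.
  move=> sx sy xy; apply/subr0_eq/innerxx_eq0.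
  by rewrite innerBr xy ?subrr// (linB sl) sx sy subrr.
have Nx x : s x = 0 -> N x = x by move=> sx; apply: s_eq => // z /Nin.
have NN x : N (N x) = N x by apply: Nx.
exists N; last split=> [x|b bb bs x].
- split=> //; split=> // x y; rewrite -(Nin y (N x))//.
  by apply: inner_eqC; rewrite Nin.
- by split=> [<-//|]; apply: Nx.
have bl : linear b by case: bb.
apply: s_eq => // [|z sz]; first by rewrite -bs Nk (lin0 bl).
rewrite Nin//; have [c bc cb] := adjoint_ex _ bb.
have sc : s (c z) = 0.
  apply: inner_inj => y.
  by rewrite ss (adjoint_sym _ _ bc) bs -ss sz !inner0r.

by rewrite !bc Nin.
Qed.

Lemma nondecreasing_bounded_cauchy (u : nat -> R) (M : R) : {homo u : n m / (n <= m)%N >-> n <= m} ->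
  (forall n, u n <= M) ->
  forall e, 0 < e -> exists N, forall n m, (N <= n)%N -> (N <= m)%N -> u n - u m < e.
Proof.
move=> um uM e e0; pose S := range u.
have Ss : has_sup S.
  by split; [exists (u 0%N), 0%N|exists M => _ [n _ <-]].
have [_ [N _ <-] h] := sup_adherent e0 Ss.
exists N => n m Nn Nm; have : u n <= sup S by apply: ub_le_sup; [case: Ss|exists n].
by have := um _ _ Nm; lra.
Qed.

(* The iteration [q <- (z + q^2)/2] converges in norm: its steps are dominated
   by those of the scalar iteration [t <- (1 + t^2)/2]. *)
Lemma sqrt_one_sub (z : H -> H) (r : R) : selfadjoint z -> 0 <= r -> r <= 1 ->
  (forall x, nm (z x) <= r * nm x) ->
  exists q, [/\ selfadjoint q, forall x, nm (q x) <= r * nm x,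
    forall x, q (q x) + z x = q x + q x &
    forall b, bounded_op b -> (forall x, b (z x) = z (b x)) ->
       forall x, b (q x) = q (b x)].
Proof.
move=> [zb zz] r0 r1 zr; have zl : linear z by case: zb.
(* A fixed point satisfies [q^2 + z = 2 q], that is, [(1 - q)^2 = 1 - z]. The initial zero operator
   is written as a multiple of [z] to inherit boundedness and selfadjointness. *)
pose Q := fix Q n : H -> H := if n is m.+1
  then (2^-1 : R)%:C%C \*: (z \+ (Q m \o Q m)) else 0%:C%C \*: z.
pose t := fix t n : R := if n is m.+1 then (1 + t m ^+ 2) / 2 else 0.
have Qsa n : selfadjoint (Q n).
  elim: n => [|n [Qb Qa]].
    split; first exact: bounded_scale.
    by have := adjoint_scale 0%:C%C _ _ zz; rewrite conjc_real; apply.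
  split; first by apply/bounded_scale/bounded_add => //; apply: bounded_comp.
  have := adjoint_scale (2^-1 : R)%:C%C _ _
    (adjoint_add _ _ _ _ zz (adjoint_comp _ _ _ _ Qa Qa)).
  by rewrite conjc_real; apply.
have Ql n : linear (Q n) by case: (Qsa n) => [[]].
have Qcomm b : linear b -> (forall x, b (z x) = z (b x)) ->
    forall n x, b (Q n x) = Q n (b x).
  move=> bl bz; elim=> [|n IH] x /=; first by rewrite (linZ bl) bz.
  by rewrite (linZ bl) (linD bl) bz !IH.
have t01 n : 0 <= t n <= 1.
  by elim: n => [|n /= /andP[t0 t1]]; [rewrite lexx ler01|apply/andP; split; nra].
have half (x y : H) : nm ((2^-1 : R)%:C%C *: (x + y)) <= (nm x + nm y) / 2.
  by rewrite nmZ ger0_norm ?invr_ge0// mulrC ler_wpM2r ?invr_ge0 ?nm_triangle.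
have Qr n x : nm (Q n x) <= r * nm x.
  elim: n x => [|n IH] x /=.
    by rewrite nmZ normr0 mul0r mulr_ge0 ?nm_ge0.
  rewrite (le_trans (half _ _))//.
  have := zr x; have := IH (Q n x); have := IH x; have := nm_ge0 x.
  have := nm_ge0 (Q n x) => h1 h2 h3 h4 h5.
  have : r * nm (Q n x) <= nm (Q n x) by nra.
  nra.
have Qt n x : nm (Q n x) <= t n * nm x.
  elim: n x => [|n IH] x /=; first by rewrite nmZ normr0 !mul0r.
  rewrite (le_trans (half _ _))//.
  have := zr x; have := IH (Q n x); have := IH x; have := nm_ge0 x.
  have /andP[t0 t1] := t01 n.
  move=> h1 h2 h3 h4; have : t n * nm (Q n x) <= t n * (t n * nm x) by rewrite ler_wpM2l.
  have : r * nm x <= nm x by nra.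
  nra.
have step n x : nm (Q n.+1 x - Q n x) <= (t n.+1 - t n) * nm x.
  elim: n x => [|n IH] x.
    have Q0 y : Q 0%N y = 0 by exact: scale0r.
    have -> : Q 1%N x = (2^-1 : R)%:C%C *: (z x + Q 0%N (Q 0%N x)) by [].
    rewrite !Q0 subr0 (le_trans (half _ _))// nm0 /=.
    by have := zr x; have := nm_ge0 x; nra.
  (* The difference of squares is split as [Q' (Q' - Q) + (Q' - Q) Q]; the scalar sequence [t]
     satisfies the same identity, so the bounds propagate. *)
  have -> : Q n.+2 x - Q n.+1 x =
      (2^-1 : R)%:C%C *: (Q n.+1 (Q n.+1 x - Q n x) +
                         (Q n.+1 (Q n x) - Q n (Q n x))).
    rewrite (linB (Ql n.+1)) addrA subrK.
    have -> : Q n.+2 x = (2^-1 : R)%:C%C *: (z x + Q n.+1 (Q n.+1 x)) by [].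
    have -> : Q n.+1 x = (2^-1 : R)%:C%C *: (z x + Q n (Q n x)) by [].
    by rewrite -scalerBr opprD addrACA subrr add0r.
  rewrite (le_trans (half _ _))//.
  have h1 := Qt n.+1 (Q n.+1 x - Q n x); have h2 := IH x.
  have h3 := IH (Q n x); have h4 := Qt n x.
  have /andP[t0 t1] := t01 n.+1; have /andP[t0' t1'] := t01 n.
  have tt : 0 <= t n.+1 - t n by rewrite /=; have := sqr_ge0 (1 - t n); nra.
  have h5 : t n.+1 * nm (Q n.+1 x - Q n x) <= t n.+1 * ((t n.+1 - t n) * nm x).
    by rewrite ler_wpM2l.
  have h6 : (t n.+1 - t n) * nm (Q n x) <= (t n.+1 - t n) * (t n * nm x).
    by rewrite ler_wpM2l.
  have -> : t n.+2 - t n.+1 = (t n.+1 - t n) * (t n.+1 + t n) / 2.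
    have -> : t n.+2 - t n.+1 = (1 + t n.+1 ^+ 2) / 2 - (1 + t n ^+ 2) / 2 by [].
    by field.
  move: h1 h3 h5 h6; move: (t n.+1) (t n) => A B; lra.
have tS n : t n <= t n.+1 by have := sqr_ge0 (1 - t n); rewrite /=; nra.
have tm : {homo t : n m / (n <= m)%N >-> n <= m} by apply: homo_leq => //; apply: le_trans.
have Qd n m x : (n <= m)%N -> nm (Q m x - Q n x) <= (t m - t n) * nm x.
  elim: m => [|m IH]; first by rewrite leqn0 => /eqP ->; rewrite !subrr nm0 mul0r.
  rewrite leq_eqVlt => /predU1P[->|]; first by rewrite !subrr nm0 mul0r.
  rewrite ltnS => /IH h; have -> : Q m.+1 x - Q n x = (Q m.+1 x - Q m x) + (Q m x - Q n x).
    by rewrite addrA subrK.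
  rewrite (le_trans (nm_triangle _ _))// (le_trans (lerD (step _ _) h))//.
  by rewrite -mulrDl addrA subrK.
have Qe e : 0 < e -> exists N, forall n m x, (N <= n)%N -> (N <= m)%N ->
    nm (Q m x - Q n x) <= e * nm x.
  move=> /(nondecreasing_bounded_cauchy t 1 tm (fun n => proj2 (andP (t01 n)))) [N NP]; exists N => n m x Nn Nm.
  have [nm_|mn] := leqP n m.
    by rewrite (le_trans (Qd _ _ _ nm_))// ler_wpM2r ?nm_ge0// ltW ?NP.
  by rewrite nmB (le_trans (Qd _ _ _ (ltnW mn)))// ler_wpM2r ?nm_ge0// ltW ?NP.
have cau x : exists l, forall e, 0 < e ->
    exists N, forall n, (N <= n)%N -> nm (l - Q n x) < e.
  apply: nm_complete => e e0.
  have xp : 0 < nm x + 1 by have := nm_ge0 x; lra.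
  have [N NP] := Qe (e / (nm x + 1)) (divr_gt0 e0 xp).
  exists N => n m Nn Nm; rewrite (le_lt_trans (NP m n x Nm Nn))//.
  by rewrite mulrAC ltr_pdivrMr// ltr_pM2l//; lra.
have [q qP] := choice cau.
(* Two consecutive approximants are controlled at once in order to pass to the limit in the
   recursion. *)
have qQ e : 0 < e -> exists n, (forall x, nm (q x - Q n x) <= e * nm x) /\
    forall x, nm (q x - Q n.+1 x) <= e * nm x.
  move=> e0; have [N NP] := Qe e e0.
  have qN n x : (N <= n)%N -> nm (q x - Q n x) <= e * nm x.
    move=> Nn; rewrite -subr_le0; apply: (le0_eps _ 1) => // d d0 _.
    have [M MP] := qP x _ d0.
    have := NP n _ x Nn (leq_maxl N M); have := MP _ (leq_maxr N M).
    have := nm_triangle (q x - Q (maxn N M) x) (Q (maxn N M) x - Q n x).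
    by rewrite addrA subrK; lra.
  by exists N; split=> x; apply: qN.
have zero (x : H) (K : R) : 0 <= K -> (forall e, 0 < e -> nm x <= e * K) -> x = 0.
  move=> K0 h; apply/nm_eq0/eqP; rewrite eq_le nm_ge0 andbT.
  by apply: (le0_eps _ K) => // e e0 _; apply: h.
have qr x : nm (q x) <= r * nm x.
  rewrite -subr_le0; apply: (le0_eps _ (nm x)) => [|e e0 _]; first exact: nm_ge0.
  have [n [qn _]] := qQ e e0; have := Qr n x; have := qn x.
  have := nm_triangle (q x - Q n x) (Q n x); rewrite subrK; lra.
have ql : linear q.
  move=> k x y; apply/subr0_eq.
  apply: (zero _ (nm (k *: x + y) + complex.Re `|k| * nm x + nm y)).
    by rewrite !addr_ge0 ?mulr_ge0 ?Re_norm_ge0 ?nm_ge0.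
  move=> e e0; have [n [qn _]] := qQ e e0.
  have -> : q (k *: x + y) - (k *: q x + q y) =
      (q (k *: x + y) - Q n (k *: x + y)) - (k *: (q x - Q n x) + (q y - Q n y)).
    by rewrite (Ql n k x y) scalerBr; rewrite addrACA -opprD opprB addrA subrK.
  rewrite (le_trans (nm_triangle _ _))// nmN.
  have := nm_triangle (k *: (q x - Q n x)) (q y - Q n y); rewrite nmZc.
  have := qn (k *: x + y); have := qn y.
  have : complex.Re `|k| * nm (q x - Q n x) <= complex.Re `|k| * (e * nm x).
    by rewrite ler_wpM2l ?Re_norm_ge0.
  lra.
have qb : bounded_op q by apply/bounded_opP; split=> //; exists r.
exists q; split=> //.
- split=> //; apply/adjointP => // x y.
  apply/subr0_eq/eqP; rewrite -normr_le0.
  apply: (le0_eps _ (nm x * nm y + nm x * nm y)).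
    by rewrite addr_ge0 ?mulr_ge0 ?nm_ge0.
  move=> e e0 _; have [n [qn _]] := qQ e e0.
  have -> : rip x (q y) - rip (q x) y = rip x (q y - Q n y) - rip (q x - Q n x) y.
    by rewrite ripDr ripDl ripNl ripNr (rip_sa _ _ _ (proj2 (Qsa n))); ring.
  rewrite (le_trans (ler_normB _ _))//.
  have := rip_abs_le x (q y - Q n y); have := rip_abs_le (q x - Q n x) y.
  have : nm x * nm (q y - Q n y) <= nm x * (e * nm y) by rewrite ler_wpM2l ?nm_ge0.
  have : nm (q x - Q n x) * nm y <= (e * nm x) * nm y by rewrite ler_wpM2r ?nm_ge0.
  lra.
- move=> x; apply/subr0_eq; apply: (zero _ (nm (q x) + nm x + 2 * nm x)).
    by rewrite !addr_ge0 ?mulr_ge0 ?nm_ge0.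
  move=> e e0; have [n [qn qn1]] := qQ e e0.
  have QQ : Q n.+1 x + Q n.+1 x = z x + Q n (Q n x).
    by rewrite /= -scalerDl -rmorphD /= -[2^-1]div1r -splitr scale1r.
  have -> : q (q x) + z x - (q x + q x) =
      (q (q x) - Q n (q x)) + Q n (q x - Q n x)
      - ((q x - Q n.+1 x) + (q x - Q n.+1 x)).
    apply: vecP => w; have := congr1 (rip^~ w) QQ.
    by rewrite (linB (Ql n)) !ripE; lra.
  have := nm_triangle ((q (q x) - Q n (q x)) + Q n (q x - Q n x))
    (- ((q x - Q n.+1 x) + (q x - Q n.+1 x))); rewrite nmN.
  have := nm_triangle (q (q x) - Q n (q x)) (Q n (q x - Q n x)).
  have := nm_triangle (q x - Q n.+1 x) (q x - Q n.+1 x).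
  have := qn (q x); have := qn1 x; have := qn x; have := Qt n (q x - Q n x).
  have /andP[t0 t1] := t01 n; have := nm_ge0 (q x - Q n x) => h0 h1.
  have : t n * nm (q x - Q n x) <= 1 * nm (q x - Q n x) by rewrite ler_wpM2r.
  lra.
move=> b /bounded_opP[bl [C C0 bC]] bz x; apply/subr0_eq.
apply: (zero _ (C * nm x + nm (b x))); first by rewrite addr_ge0 ?mulr_ge0 ?nm_ge0.
move=> e e0; have [n [qn _]] := qQ e e0.
have -> : b (q x) - q (b x) = b (q x - Q n x) - (q (b x) - Q n (b x)).
  by rewrite (linB bl) (Qcomm b bl bz) opprB addrA subrK.
rewrite (le_trans (nm_triangle _ _))// nmN mulrDr lerD//.
by rewrite (le_trans (bC _))// mulrCA ler_wpM2l.
Qed.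

End SelfAdjoint.

(** * Unitaries, sign projections and the numerical radius *)

Section Functional.
Context {R : realType} {H : hilbertType R}.
Implicit Types (a b c h : H -> H) (x y : H).

Lemma sa_linear a : selfadjoint a -> linear a.
Proof. by case=> [[]]. Qed.

Lemma sa_id : selfadjoint (idfun : H -> H).
Proof. by split; [exact: bounded_id|]. Qed.

Lemma sa_add a b : selfadjoint a -> selfadjoint b -> selfadjoint (a \+ b).
Proof. by move=> [ab aa] [bb ba]; split; [apply: bounded_add|apply: adjoint_add]. Qed.

Lemma sa_scale (r : R) a : selfadjoint a -> selfadjoint (r%:C%C \*: a).
Proof.
move=> [ab aa]; split; first exact: bounded_scale.
by have := adjoint_scale r%:C%C _ _ aa; rewrite conjc_real.
Qed.

Lemma sa_comp a b : selfadjoint a -> selfadjoint b ->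
  (forall x, a (b x) = b (a x)) -> selfadjoint (a \o b).
Proof.
move=> [ab aa] [bb ba] comm; split; first exact: bounded_comp.
by have := adjoint_comp _ _ _ _ aa ba; rewrite (_ : b \o a = a \o b)//; apply/funext => x /=.
Qed.

Lemma nm_sqr_le (x y : H) : rip x x <= rip y y -> nm x <= nm y.
Proof. by rewrite !rip_nm ler_pXn2r// nnegrE nm_ge0. Qed.

(** The square norm of [x - h (h x)] is [|x|^2 - 2 |h x|^2 + |h (h x)|^2], and
    [|h (h x)| <= |h x|]. *)
Lemma nm_one_sub_sqr h : selfadjoint h -> (forall x, nm (h x) <= nm x) ->
  forall x, nm (x - h (h x)) <= nm x.
Proof.
move=> [_ hh] h1 x; apply: nm_sqr_le.
rewrite !ripE (ripC (h (h x)) x) (rip_sa _ _ _ hh).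
rewrite !rip_nm.
have := h1 (h x); have := nm_ge0 (h (h x)); have := nm_ge0 (h x).
nra.
Qed.

Definition one_sub c : H -> H := idfun \+ (-1 : R)%:C%C \*: c.

Lemma one_subE c x : one_sub c x = x - c x.
Proof. by rewrite /one_sub /= rmorphN1 scaleN1r. Qed.

Lemma sa_one_sub c : selfadjoint c -> selfadjoint (one_sub c).
Proof. by move=> cs; apply: sa_add; [exact: sa_id|exact: sa_scale]. Qed.

(** Here [c] is [sqrt (1 - h^2)], the companion of [h] in the unitary [c + i h]. It differs from the
    identity only to second order in [r], which serves first-order perturbation. *)
Lemma cosine_exists h (r : R) : selfadjoint h -> 0 <= r -> r <= 1 ->
  (forall x, nm (h x) <= r * nm x) ->
  exists c, [/\ selfadjoint c, forall x, nm (x - c x) <= r ^+ 2 * nm x,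
    forall x, c (c x) = x - h (h x) &
    forall b, bounded_op b -> (forall x, b (h x) = h (b x)) ->
       forall x, b (c x) = c (b x)].
Proof.
move=> hs r0 r1 hr; have zs := sa_comp _ _ hs hs (fun=> erefl).
have [||x|q [qs qr qq qc]] := sqrt_one_sub _ (r ^+ 2) zs.
- exact: sqr_ge0.
- by rewrite expr_le1.
- by rewrite (le_trans (hr _))// expr2 -mulrA ler_wpM2l.
have ql := sa_linear _ qs.
exists (one_sub q); split=> [|x|x|b bb bh x].
- exact: sa_one_sub.
- by rewrite one_subE opprB addrC subrK.
- rewrite !one_subE (linB ql); apply: vecP => w.
  by have := congr1 (rip^~ w) (qq x); rewrite /= !ripE; lra.
- have bl : linear b by case: bb.
  by rewrite !one_subE (linB bl) qc// => y /=; rewrite !bh.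
Qed.

(** The scalar [e] stands for ['i] or [- 'i]: the conditions on it make [c - e h] both the adjoint
    and the inverse of [c + e h]. *)
Lemma unitary_pair c h (e : R[i]) : (e^*)%C = - e -> e * e = -1 ->
  selfadjoint c -> selfadjoint h -> (forall x, c (h x) = h (c x)) ->
  (forall x, c (c x) = x - h (h x)) ->
  unitary_op (c \+ e \*: h).
Proof.
move=> eN ee cs hs ch cc.
have cl := sa_linear _ cs; have hl := sa_linear _ hs.
have [cb ca] := cs; have [hb ha] := hs.
split; first by apply: bounded_add => //; apply: bounded_scale.
exists (c \+ - e \*: h).
  by apply: adjoint_add => //; rewrite -eN; apply: adjoint_scale.
have inv (f : R[i]) x : f * f = -1 -> (c \+ - f \*: h) ((c \+ f \*: h) x) = x.
  move=> ff /=; rewrite (linD cl) (linD hl) (linZ cl) (linZ hl) cc ch.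
  by rewrite scalerDr scalerA mulNr ff opprK scale1r scaleNr addrA addrK subrK.
split; apply/funext => x; first exact: inv.
by have := inv (- e) x; rewrite opprK mulrNN; apply.
Qed.

(* [N] projects onto the kernel of [|T| + T], where [|T| = sqrt (T^2)]. *)
Lemma sign_projection T : selfadjoint T ->
  exists2 N : H -> H, projection N &
    [/\ forall x, N x = x -> rip x (T x) <= 0,
        forall x, N x = 0 -> 0 <= rip x (T x) &
        forall b, bounded_op b -> (forall x, b (T x) = T (b x)) ->
          forall x, b (N x) = N (b x)].
Proof.
move=> /[dup] Tsa [/bounded_opP [Tl [C C0 TC]] _].
have C1 : 0 < C + 1 by lra.
(* Rescaling gives a contraction; [C + 1] rather than [C] avoids dividing by 0. *)
pose S : H -> H := ((C + 1)^-1)%:C%C \*: T.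
have Ss : selfadjoint S by apply: sa_scale.
have Sl := sa_linear _ Ss.
have S1 x : nm (S x) <= nm x.
  rewrite nmZ gtr0_norm ?invr_gt0// ler_pdivrMl//.
  by have := TC x; have := nm_ge0 x; nra.
have zs := sa_one_sub _ (sa_comp _ _ Ss Ss (fun=> erefl)).
have [|//||q [qs qr qq qc]] := sqrt_one_sub _ 1 zs.
- exact: ler01.
- by move=> x; rewrite one_subE mul1r; apply: nm_one_sub_sqr.
have ql := sa_linear _ qs.
(* Since [(1 - q)^2 = 1 - (1 - S^2)], this [c] is [|S|]; its positivity comes from [q] being a
   contraction. *)
pose c := one_sub q; have cs : selfadjoint c by apply: sa_one_sub.
have cl := sa_linear _ cs.
have cc x : c (c x) = S (S x).
  rewrite /c !one_subE (linB ql); apply: vecP => w.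
  by have := congr1 (rip^~ w) (qq x); rewrite /= one_subE !ripE /=; lra.
have c0 x : 0 <= rip x (c x).
  rewrite /c one_subE ripDr ripNr rip_nm.
  have := rip_le x (q x); have := qr x; rewrite mul1r; have := nm_ge0 x; nra.
have cbS b : bounded_op b -> (forall x, b (S x) = S (b x)) ->
    forall x, b (c x) = c (b x).
  move=> bb bS x; have bl : linear b by case: bb.
  rewrite /c !one_subE (linB bl) qc// => y.
  by rewrite !one_subE (linB bl) /= !bS.
have cS x : S (c x) = c (S x) by apply: cbS => //; case: Ss.
have [N Np [Nk Nb]] := kernel_projection _ (sa_add _ _ cs Ss).
have TS x : T x = (C + 1)%:C%C *: S x.
  by rewrite /S /= scalerA -rmorphM /= divff ?gt_eqF// scale1r.
exists N => //; split=> [x /Nk /= h|x Nx|b bb bT x].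
- rewrite TS ripZr pmulr_rle0//.
  have -> : S x = - c x by apply/eqP; rewrite eq_sym -subr_eq0 -opprD oppr_eq0 h.
  by rewrite ripNr oppr_le0.
(* As [(|S| + S) (S - |S|) = 0], the range of [S - |S|] is fixed by [N]. Because [N] commutes with
   both operators, [N x = 0] gives [S x = |S| x]. *)
- have h : N (S x - c x) = S x - c x.
    by apply/Nk; rewrite /= (linB cl) (linB Sl) cc cS addrA subrK subrr.
  have Nl := sa_linear _ Np.1.
  have NS y : S (N y) = N (S y).
    apply: Nb; first by case: Ss.
    by move=> t /=; rewrite (linD Sl) cS.
  have Nc y : c (N y) = N (c y).
    apply: Nb; first by case: cs.
    by move=> t /=; rewrite (linD cl) cS.
  move: h; rewrite (linB Nl) -NS -Nc Nx (lin0 Sl) (lin0 cl) subrr => /esym/subr0_eq.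
  by rewrite TS ripZr => ->; rewrite pmulr_rge0.
- apply: Nb => // y /=; have bl : linear b by case: bb.
  have bS t : b (S t) = S (b t) by rewrite /S /= (linZ bl) bT.
  by rewrite (linD bl) bS cbS.
Qed.

Lemma pythagoras N : projection N ->
  forall x, nm x ^+ 2 = nm (N x) ^+ 2 + nm (x - N x) ^+ 2.
Proof.
move=> [[_ NA] NN] x.
have e : rip x (N x) = rip (N x) (N x) by rewrite -(rip_sa _ _ _ NA) NN.
by rewrite -!rip_nm !ripE (ripC (N x) x) e; ring.
Qed.

(** Polarise between [x] and the multiple [y] of [T x] that has the norm of [x]: the forms at
    [x + y] and [x - y] differ by [4 |x| |T x|], while their bounds add up to [4 r |x|^2]. The
    vectors fixed by [P] include [y] because [P] commutes with [T]. *)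
Lemma numerical_radius (T P : H -> H) (r : R) : selfadjoint T -> linear P ->
  (forall x, T (P x) = P (T x)) ->
  (forall x, P x = x -> `|rip x (T x)| <= r * nm x ^+ 2) ->
  forall x, P x = x -> nm (T x) <= r * nm x.
Proof.
move=> /[dup] Ts [_ TA] Pl TP Tr x Px; have Tl := sa_linear _ Ts.
have [x0|x0] := eqVneq (nm x) 0.
  by rewrite (nm_eq0 _ x0) (lin0 Tl) nm0 mulr0.
have xp : 0 < nm x by rewrite lt_def x0 nm_ge0.
have [Tx0|Tx0] := eqVneq (nm (T x)) 0.
  rewrite Tx0; have := le_trans (normr_ge0 _) (Tr x Px).
  by rewrite expr2 mulrA pmulr_lge0.
have Tp : 0 < nm (T x) by rewrite lt_def Tx0 nm_ge0.
pose t := nm x / nm (T x).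
have [y yE] : exists y, y = t%:C%C *: T x by eexists.
have Py : P y = y by rewrite yE (linZ Pl) -TP Px.
have h1 : `|rip (x - y) (T (x - y))| <= r * nm (x - y) ^+ 2.
  by apply: Tr; rewrite (linB Pl) Px Py.
have h2 : `|rip (x + y) (T (x + y))| <= r * nm (x + y) ^+ 2.
  by apply: Tr; rewrite (linD Pl) Px Py.
have := le_trans (ler_norm _) h2.
have := lerNnormlW h1.
rewrite -!rip_nm (linB Tl) (linD Tl) !ripE.
have xTy : rip x (T y) = t * nm (T x) ^+ 2.
  by rewrite (rip_sa _ _ _ TA) yE ripZr rip_nm.
have yTx : rip y (T x) = t * nm (T x) ^+ 2 by rewrite yE ripZl rip_nm.
have yy : rip y y = nm x ^+ 2.
  by rewrite rip_nm yE nmZ ger0_norm ?divr_ge0 ?nm_ge0// mulfVK.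
have tT : t * nm (T x) ^+ 2 = nm x * nm (T x).
  by rewrite expr2 mulrA mulfVK.
rewrite xTy yTx yy tT (rip_nm x) => h3 h4.
have : nm x * nm (T x) <= nm x * (r * nm x) by move: h3 h4; lra.
by rewrite ler_pM2l.
Qed.

End Functional.

(** * Commutants and hermitian parts *)

Section Commutants.
Context {R : realType} {H : hilbertType R} {M : set (H -> H)}.
Context (hM : von_neumann_algebra M).
Implicit Types (a b x y : H -> H).

Let Mb a : M a -> bounded_op a.
Proof. exact: vna_bounded. Qed.

Let Ml a : M a -> linear a.
Proof. by move=> /Mb []. Qed.

Lemma commutantP x :
  commutant M x <-> bounded_op x /\ forall a, M a -> forall t, x (a t) = a (x t).
Proof.
split=> [[xb xM]|[xb xM]]; split=> // a Ma.
  by move=> t; have := congr1 (@^~ t) (xM a Ma).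
by apply/funext => t; apply: xM.
Qed.

Lemma commutant_id : commutant M idfun.
Proof. by apply/commutantP; split=> //; apply: bounded_id. Qed.

Lemma commutant_add x y : commutant M x -> commutant M y -> commutant M (x \+ y).
Proof.
move=> /commutantP[xb xM] /commutantP[yb yM].
apply/commutantP; split=> [|a Ma t]; first exact: bounded_add.
by rewrite /= (linD (Ml _ Ma)) xM// yM.
Qed.

Lemma commutant_scale (k : R[i]) x : commutant M x -> commutant M (k \*: x).
Proof.
move=> /commutantP[xb xM]; apply/commutantP.
split=> [|a Ma t]; first exact: bounded_scale.
by rewrite /= (linZ (Ml _ Ma)) xM.
Qed.

Lemma commutant_comp x y : commutant M x -> commutant M y -> commutant M (x \o y).
Proof.
move=> /commutantP[xb xM] /commutantP[yb yM].
apply/commutantP; split=> [|a Ma t]; first exact: bounded_comp.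
by rewrite /= yM// xM.
Qed.

Lemma commutant_adjoint x y : commutant M x -> adjoint x y -> commutant M y.
Proof.
move=> /commutantP[xb xM] xy; have [y' xy' yb] := adjoint_ex _ xb.
rewrite -(adjoint_uniq _ _ _ xy xy') in yb *.
apply/commutantP; split=> // a Ma t; apply: inner_inj => s.
have [a' aa' Ma'] := vna_adjoint hM Ma; have yx := adjoint_sym _ _ xy.
by rewrite yx !aa' yx xM.
Qed.

Lemma hermitian_parts x : commutant M x -> exists h k : H -> H,
  [/\ selfadjoint h /\ commutant M h, selfadjoint k /\ commutant M k,
    forall t, x t = h t + ('i *: k t)%C &
    forall C : R, (forall t, nm (x t) <= C * nm t) ->
      (forall t, nm (h t) <= C * nm t) /\ (forall t, nm (k t) <= C * nm t)].
Proof.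
move=> /[dup] Mx [xb _]; have [y xy yb] := adjoint_ex _ xb.
have My := commutant_adjoint _ _ Mx xy; have yx := adjoint_sym _ _ xy.
(* The scalars [c] and [d] are [1/2] and [1/(2i)], and [y] is the adjoint of [x]. *)
pose c := (2^-1 : R)%:C%C; pose d : R[i] := (0 +i* - (2^-1 : R))%C.
have cc : (c^*)%C = c by rewrite conjc_real.
have dd : (d^*)%C = - d.
  by rewrite /d; apply/eqP; rewrite eq_complex /= oppr0 !eqxx.
have di : 'i%C * d = c.
  by rewrite /d /c; apply/eqP; rewrite eq_complex /=; apply/andP; split; apply/eqP; ring.
exists (c \*: (x \+ y)), (d \*: (x \+ ((-1) \*: y))); split.
- split; last by apply/commutant_scale/commutant_add.
  split; first by apply/bounded_scale/bounded_add.
  have := adjoint_scale c _ _ (adjoint_add _ _ _ _ xy yx); rewrite cc.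
  by rewrite (_ : y \+ x = x \+ y)//; apply/funext => t /=; rewrite addrC.
- split; last by apply/commutant_scale/commutant_add => //; apply: commutant_scale.
  split; first by apply/bounded_scale/bounded_add => //; apply: bounded_scale.
  have := adjoint_scale d _ _ (adjoint_add _ _ _ _ xy (adjoint_scale (-1) _ _ yx)).
  rewrite dd (_ : ((-1 : R[i])^*)%C = -1) ?rmorphN1//
    (_ : - d \*: _ = d \*: (x \+ ((-1) \*: y)))//.
  by apply/funext => t /=; rewrite scaleN1r scaleN1r scaleNr -scalerN opprD opprK addrC.
- move=> t /=; rewrite scalerA di -scalerDr addrACA scaleN1r subrr addr0.
  by apply: vecP => w; rewrite /c !ripE; lra.
move=> C xC.
(* The adjoint has the same bound: [|y t|^2 = <t, x (y t)> <= |t| C |y t|]. *)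
have yC t : nm (y t) <= C * nm t.
  have [y0|y0] := eqVneq (nm (y t)) 0.
    by rewrite y0 (le_trans _ (xC t))// nm_ge0.
  have yp : 0 < nm (y t) by rewrite lt_def y0 nm_ge0.
  have := rip_le t (x (y t)).
  rewrite /rip xy -/(rip (y t) (y t)) rip_nm => h.
  have := le_trans h (ler_wpM2l (nm_ge0 t) (xC (y t))).
  by rewrite mulrCA mulrA expr2 ler_pM2r.
have hf (t s : H) : nm (t + s) <= nm t + nm s by apply: nm_triangle.
have n2 : `|2^-1 : R| = 2^-1 by rewrite gtr0_norm ?invr_gt0.
split=> t /=.
  rewrite nmZ n2; have := hf (x t) (y t); have := xC t; have := yC t; lra.
have -> : nm (d *: (x t + -1 *: y t)) = nm (c *: (x t - y t)).
  by rewrite -[LHS]nm_i scalerA di scaleN1r.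
by rewrite nmZ n2; have := hf (x t) (- y t); rewrite nmN; have := xC t; have := yC t; lra.
Qed.

End Commutants.

(** * Partial isometries from equal marginals *)

Section Intertwiner.
Context {R : realType} {H : hilbertType R} {M : set (H -> H)}.
Context (hM : von_neumann_algebra M).

(** Both inner products are marginals at the product of the adjoint of [a] with [b], an element of
    [M]. *)
Lemma same_marginal_inner (Psi Phi : H) a b : same_marginal M Psi Phi ->
  M a -> M b -> inner (a Psi) (b Psi) = inner (a Phi) (b Phi).
Proof.
move=> mar Ma Mb; have [a' aa' Ma'] := vna_adjoint hM Ma.
have aA := adjoint_sym _ _ aa'.
by rewrite -!aA; apply: (mar (a' \o b)); apply: vna_comp hM _ _ Ma' Mb.
Qed.

(* [v] is the closure of [a Psi |-> a Phi], extended by 0 on the orthogonal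
   complement of [M Psi]. *)
Lemma marginal_partial_isometry (Psi Phi : H) : same_marginal M Psi Phi ->
  exists v, [/\ commutant M v, partial_isometry v, v Psi = Phi &
    forall x, nm (v x) <= nm x].
Proof.
move=> mar.
(* The relation sends [a Phi] back to [a Psi], because [relation_adjoint] returns the adjoint, which
   inverts an isometry. *)
pose G (p q : H) := exists2 a, M a & p = a Psi /\ q = a Phi.
have Mid := vna_id hM.
have Mlin a : M a -> linear a by move=> /(vna_bounded hM) [].
have Gin a : M a -> G (a Psi) (a Phi) by move=> Ma; exists a.
have [||p q [a Ma [-> ->]]|v [vl vn v1 v2]] := relation_adjoint G 1 ler01.
- exists (0 \*: idfun); first exact: vna_scale.
  by rewrite /= !scale0r.
- move=> p q p' q' k [a Ma [-> ->]] [b Mb [-> ->]].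
  exists ((k \*: a) \+ b) => //; apply: (vna_add hM) => //; exact: (vna_scale hM).
- rewrite mul1r; apply: nm_sqr_le.
  by rewrite /rip (same_marginal_inner _ _ _ _ mar).
have vb : bounded_op v by apply/bounded_opP; split=> //; exists 1.
(* The closure of [M Phi] is encoded as a double orthogonal complement; its vectors are determined
   by their inner products with the [a Phi]. *)
have ranP (x y : H) :
    (forall z, (forall a, M a -> inner z (a Phi) = 0) -> inner z x = 0) ->
    (forall z, (forall a, M a -> inner z (a Phi) = 0) -> inner z y = 0) ->
    (forall a, M a -> inner (a Phi) x = inner (a Phi) y) -> x = y.
  move=> xr yr xy; apply/subr0_eq/innerxx_eq0.
  have dP a : M a -> inner (x - y) (a Phi) = 0.
    by move=> Ma; apply: inner_eq0C; rewrite innerBr xy // subrr.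
  by rewrite innerBr xr // yr // subrr.
have vran x z : (forall a, M a -> inner z (a Phi) = 0) -> inner z (v x) = 0.
  by move=> zP; apply: v2 => p q [a Ma [_ ->]]; apply: zP.
have vin a x : M a -> inner (a Phi) (v x) = inner (a Psi) x.
  by move=> Ma; apply: v1; apply: Gin.
have va a : M a -> v (a Psi) = a Phi.
  move=> Ma; apply: ranP => [|z|b Mb]; first exact: vran.
    exact.
  by rewrite vin// (same_marginal_inner _ _ _ _ mar).
have [w vw wb] := adjoint_ex _ vb.
have wv := adjoint_sym _ _ vw.
exists v; split.
- apply/commutantP => //; split=> // a Ma x.
  have [a' aa' Ma'] := vna_adjoint hM Ma.
  apply: ranP => [|z zP|b Mb]; first exact: vran.
    rewrite aa'; apply: vran => b Mb.
    by rewrite -aa'; apply: (zP (a \o b)); apply: (vna_comp hM).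
  rewrite vin// !aa' -(vin (a' \o b))//; exact: (vna_comp hM).
- split=> //; exists w => //; apply/funext => x /=.
  (* Against [b Phi], the vector [v (w (v x))] pairs as [<b Psi, w (v x)> = <v (b Psi), v x> = <b
     Phi, v x>]. *)
  apply: ranP => [||b Mb]; [exact: vran|exact: vran|].
  by rewrite vin// wv va.
- exact: (va idfun).
- by move=> x; have := vn x; rewrite mul1r.
Qed.

End Intertwiner.

(** * From Haag duality to the Uhlmann property *)

Section HaagUhlmann.
Context {R : realType} {H : hilbertType R} {M : set (H -> H)}.
Context (hM : von_neumann_algebra M).

(** This keeps square roots and sign projections inside the commutant: they commute with all that
    commutes with the operator they are built from. *)
Lemma commutant_bicommutes (x y : H -> H) : commutant M x -> bounded_op y ->
  (forall b, bounded_op b -> (forall t, b (x t) = x (b t)) ->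
     forall t, b (y t) = y (b t)) ->
  commutant M y.
Proof.
move=> /commutantP[xb xM] yb xy; apply/commutantP; split=> // a Ma t.
by apply/esym; apply: xy => [|s]; [exact: (vna_bounded hM)|rewrite xM].
Qed.

Lemma unitary_comp (u w : H -> H) :
  unitary_op u -> unitary_op w -> unitary_op (u \o w).
Proof.
move=> [ub [u' uu' [u1 u2]]] [wb [w' ww' [w1 w2]]].
split; first exact: bounded_comp.
exists (w' \o u'); first exact: adjoint_comp.
have U1 x : u' (u x) = x by exact: (congr1 (@^~ x) u1).
have U2 x : u (u' x) = x by exact: (congr1 (@^~ x) u2).
have W1 x : w' (w x) = x by exact: (congr1 (@^~ x) w1).
have W2 x : w (w' x) = x by exact: (congr1 (@^~ x) w2).
by split; apply/funext => x /=; rewrite ?U1 ?W1 ?W2 ?U2.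
Qed.

Lemma unitary_nm (u : H -> H) x : unitary_op u -> nm (u x) = nm x.
Proof.
move=> [_ [w uw [wu _]]]; apply/eqP; rewrite -(@eqrXn2 _ 2) ?nm_ge0//.
by rewrite -!rip_nm /rip uw (congr1 (@^~ x) wu : w (u x) = x).
Qed.

Lemma unitary_id : unitary_op (idfun : H -> H).
Proof. by split; [exact: bounded_id|exists idfun]. Qed.

Lemma unitary_adjoint (u w : H -> H) :
  unitary_op u -> adjoint u w -> unitary_op w.
Proof.
move=> [ub [w' uw' [wu uw'1]]] uw; rewrite (adjoint_uniq _ _ _ uw uw').
have [w'' uw'' wb] := adjoint_ex _ ub.
split; first by rewrite (adjoint_uniq _ _ _ uw' uw'').
by exists u => //; apply: adjoint_sym.
Qed.

Lemma ReNormc (k : R[i]) : complex.Re k <= complex.Re `|k|.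
Proof.
case: k => a b; rewrite normc_def /= (le_trans (ler_norm _))//.
by rewrite -sqrtr_sqr ler_wsqrtr// lerDl sqr_ge0.
Qed.

Lemma conj_i : (('i : R[i])^*)%C = - 'i%C.
Proof. by apply/eqP; rewrite eq_complex /= oppr0 !eqxx. Qed.

(* If [1] almost maximises [Re <Psi, u Phi>] over the unitaries [u] of [M'],
   then this functional is almost hermitian and almost positive on [M']. *)
Lemma near_maximum (Psi Phi : H) v (t : R) :
  0 < t -> t <= 1 -> nm Psi = 1 -> nm Phi = 1 ->
  commutant M v -> (forall x, nm (v x) <= nm x) -> v Phi = Psi ->
  (forall u, commutant M u -> unitary_op u ->
     rip Psi (u Phi) <= rip Psi Phi + t ^+ 2) ->
  1 - 8 * t <= rip Psi Phi.
Proof.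
move=> t0 t1 Psi1 Phi1 Mv v1 vPhi umax.
have [h [k [[hs Mh] [ks Mk] vhk hkn]]] := hermitian_parts hM _ Mv.
have ii : 'i%C * 'i%C = -1 :> R[i] by rewrite -expr2 sqr_i.
have [|h1 k1] := hkn 1; first by move=> x; rewrite mul1r.
pose K := rip Psi ('i *: k Phi)%C.
have hK : rip Psi (h Phi) + K = 1.
  by rewrite /K -ripDr -vhk vPhi rip_nm Psi1 expr1n.
(* The unitary [c + i t k] gains [t K] and loses at most [t^2] through [c]; near-maximality allows a
   gain of [t^2], so [t K <= 2 t^2]. *)
have K2t : K <= 2 * t.
  pose k' := t%:C%C \*: k.
  have k's : selfadjoint k' by apply: sa_scale.
  have [|c [cs cn cc cb]] := cosine_exists k' t k's (ltW t0) t1.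
    move=> x; rewrite nmZ gtr0_norm// ler_pM2l//.
    by have := k1 x; rewrite mul1r.
  have ck x : c (k' x) = k' (c x) by rewrite -cb//; case: k's.
  have Mk' : commutant M k' by apply: commutant_scale.
  have Mc : commutant M c.
    by apply: commutant_bicommutes Mk' _ cb; case: cs.
  have := umax _ (commutant_add hM _ _ Mc (commutant_scale hM 'i%C _ Mk'))
    (unitary_pair _ _ _ conj_i ii cs k's ck cc).
  rewrite /= ripDr /k' /= scalerA mulrC -scalerA ripZr -/K => h2.
  have := rip_le Psi (Phi - c Phi); have := cn Phi.
  rewrite ripDr ripNr Psi1 Phi1 mulr1 mul1r => h3 h4.
  have : t * K <= t * (2 * t) by lra.
  by rewrite ler_pM2l.
pose g := (2^-1 : R)%:C%C \*: one_sub h.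
have gs : selfadjoint g by apply/sa_scale/sa_one_sub.
have g1 x : nm (g x) <= nm x.
  rewrite nmZ one_subE gtr0_norm ?invr_gt0//.
  have := nm_triangle x (- h x); have := h1 x; rewrite nmN mul1r; lra.
have Mone x : commutant M x -> commutant M (one_sub x).
  by move=> Mx; apply: commutant_add => //; [exact: commutant_id|exact: commutant_scale].
have Mg : commutant M g by apply/commutant_scale => //; apply: Mone.
(* Averaging near-maximality over the unitaries [c + i s] and [c - i s], with [s = sqrt (1 - c^2)],
   bounds the functional at [c = 1 - g^2], so it is at least [- t^2] at [g^2]. *)
pose c := one_sub (g \o g).
have cs : selfadjoint c by apply/sa_one_sub/sa_comp.
have Mc : commutant M c by apply/Mone/commutant_comp.
have [||s [ss sn s2 sb]] := cosine_exists c 1 cs ler01.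
- exact: lexx.
- by move=> x; rewrite mul1r /c one_subE; apply: nm_one_sub_sqr.
have Ms : commutant M s.
  by apply: commutant_bicommutes Mc _ sb; case: ss.
have cS x : c (s x) = s (c x) by apply: sb => //; case: cs.
have c2 x : c (c x) = x - s (s x) by rewrite s2 opprB addrC subrK.
have := umax _ (commutant_add hM _ _ Mc (commutant_scale hM 'i%C _ Ms))
  (unitary_pair _ _ _ conj_i ii cs ss cS c2).
have ni : ((- 'i : R[i])^*)%C = - (- 'i)%C 
  by apply/eqP; rewrite eq_complex /= !oppr0 !eqxx.
have ni2 : (- 'i)%C * (- 'i)%C = -1 :> R[i] by rewrite mulrNN ii.
have := umax _ (commutant_add hM _ _ Mc (commutant_scale hM (- 'i)%C _ Ms))
  (unitary_pair _ _ _ ni ni2 cs ss cS c2).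
rewrite /= /c one_subE !ripDr scaleNr !ripNr => h2 h3.
have h4 : rip Psi (g (g Phi)) >= - t ^+ 2 by rewrite /=; lra.
have hl := sa_linear _ hs.
have gg : 4 * rip Psi (g (g Phi)) = rip Psi Phi - 2 * rip Psi (h Phi) + rip Psi (h (h Phi)).
  rewrite /g /= !one_subE (linZ hl) (linB hl) !ripE; lra.
have : rip Psi (h (h Phi)) <= 1.
  rewrite (le_trans (rip_le _ _))// Psi1 mul1r.
  by have := h1 (h Phi); have := h1 Phi; rewrite Phi1; lra.
(* With [F x = rip Psi (x Phi)], [F 1 >= 2 F h - F (h^2) - 4 t^2 >= 2 (1 - 2 t) - 1 - 4 t^2 >= 1 - 8
   t], the last since [t <= 1]. *)
nra.
Qed.

Lemma haag_uhlmann : uhlmann_property M (commutant M).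
Proof.
move=> Phi Psi Phi1 Psi1 mar e e0.
have nPhi : nm Phi = 1 by rewrite /nm Phi1.
have nPsi : nm Psi = 1 by rewrite /nm Psi1.
have [v [Mv _ vPhi v1]] := marginal_partial_isometry hM Phi Psi
  (fun a Ma => esym (mar a Ma)).
pose S : set R := [set x | exists u, [/\ commutant M u, unitary_op u & x = rip Psi (u Phi)]].
have Sle x : S x -> x <= 1.
  move=> [u [_ uu ->]]; rewrite (le_trans (rip_le _ _))//.
  by rewrite unitary_nm// nPhi nPsi mulr1.
have Ssup : has_sup S.
  split; last by exists 1.
  by exists (rip Psi Phi), idfun; split=> //; [exact: commutant_id|exact: unitary_id].
pose t := Num.min 1 (e / 8).
have t0 : 0 < t by rewrite lt_min ltr01 divr_gt0.
have t1 : t <= 1 by rewrite ge_min lexx.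
have te : t <= e / 8 by rewrite ge_min lexx orbT.
have [_ [u [Mu uu ->]] su] := sup_adherent (exprn_gt0 2 t0) Ssup.
exists u; split=> //.
have [_ [w uw [wu _]]] := uu.
have Mw : commutant M w by apply: commutant_adjoint hM _ _ Mu uw.
have ww : forall x, nm (w x) <= nm x.
  by move=> x; rewrite unitary_nm//; apply: unitary_adjoint uu uw.
suff : 1 - 8 * t <= rip Psi (u Phi).
  move=> h; have := ReNormc (inner Psi (u Phi)); rewrite -/(rip _ _) => h2.
  rewrite -(rmorph1 (real_complex R)) -rmorphB -[X in _ <= X]RRe_real ?normr_real// lecR.
  by rewrite (le_trans _ h2)// (le_trans _ h)// lerD2l lerN2; lra.
(* With [u Phi] in place of [Phi], the contraction [v \o w] still reaches [Psi], as [w] inverts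
   [u]. *)
apply: (near_maximum Psi (u Phi) (v \o w)) => //.
- by rewrite unitary_nm.
- exact: commutant_comp.
- by move=> x; rewrite (le_trans (v1 _)).
- by rewrite /= (congr1 (@^~ Phi) wu : w (u Phi) = Phi).
move=> u' Mu' uu'.
have : rip Psi (u' (u Phi)) <= sup S.
  apply: ub_le_sup; first by case: Ssup.
  by exists (u' \o u); split=> //; [exact: commutant_comp|exact: unitary_comp].
by move: su; lra.
Qed.

End HaagUhlmann.

(** * From the Uhlmann property to Haag duality *)

Section UhlmannHaag.
Context {R : realType} {H : hilbertType R} {MA MB : set (H -> H)}.
Context (hMA : von_neumann_algebra MA) (hMB : von_neumann_algebra MB).
Context (uhl : uhlmann_property MA MB).

(** Pythagoras for the projection of [y] onto the complex line of [x]: an overlap of modulus near 1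
    puts [y] near that line. *)
Lemma nm_sub_inner_scale (x y : H) : nm x = 1 -> nm y = 1 ->
  nm (y - inner x y *: x) ^+ 2 = 1 - complex.Re `|inner x y| ^+ 2.
Proof.
move=> x1 y1; rewrite normc_def /= sqr_sqrtr ?addr_ge0 ?sqr_ge0//.
rewrite [inner x y *: x]scaleE -rip_nm.
have xi : rip x ('i *: x)%C = 0 by have := rip_iN x x; rewrite ripC; lra.
have ix : rip ('i *: x)%C x = 0 by rewrite ripC.
have iii : rip ('i *: x)%C ('i *: x)%C = 1.
  by rewrite rip_iN scale_ii ripNr opprK rip_nm x1 expr1n.
have yx : rip y x = complex.Re (inner x y) by rewrite ripC.
have xy : rip x y = complex.Re (inner x y) by [].
have iy : rip ('i *: x)%C y = complex.Im (inner x y) by rewrite rip_iN innerE.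
have yi : rip y ('i *: x)%C = complex.Im (inner x y) by rewrite ripC.
by rewrite !ripE xi ix iii yx xy iy yi !rip_nm x1 y1; ring.
Qed.

(** The vectors [u Psi] and [Psi] have equal marginals on [MA], so the Uhlmann property approximates
    [u Psi] by scalar multiples of vectors [b Psi]. Closure membership is expressed by testing
    against orthogonal vectors [z]. *)
Lemma unitary_cyclic (u : H -> H) (Psi z : H) : commutant MA u -> unitary_op u ->
  (forall b, MB b -> inner z (b Psi) = 0) -> inner z (u Psi) = 0.
Proof.
move=> /commutantP[ub uMA] uu; have ul : linear u by case: ub.
wlog Psi1 : Psi / nm Psi = 1 => [hw|] zP.
  have [P0|P0] := eqVneq (nm Psi) 0.
    by rewrite (nm_eq0 _ P0) (lin0 ul) inner0r.
  have := hw ((nm Psi)^-1%:C%C *: Psi).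
  rewrite nmZ ger0_norm ?invr_ge0 ?nm_ge0// mulVf// => /(_ erefl).
  rewrite (linZ ul) innerZr => h.
  have : (nm Psi)^-1%:C%C * inner z (u Psi) = 0.
    apply: h => b Mb; have bl : linear b by case: (vna_bounded hMB Mb).
    by rewrite (linZ bl) innerZr zP// mulr0.
  move=> /eqP; rewrite mulf_eq0 => /predU1P[|/eqP//].
  by move=> [/eqP]; rewrite invr_eq0 (negbTE P0).
have uPsi1 : nm (u Psi) = 1 by rewrite unitary_nm.
have [w uw [wu _]] := uu.2.
have mar : same_marginal MA (u Psi) Psi.
  by move=> a Ma; rewrite -uMA// uw (congr1 (@^~ Psi) wu : w (u Psi) = Psi).
have n1 (x : H) : nm x = 1 -> `|x| = 1 by move=> x1; rewrite normE x1.
have small (y : H) : (forall b, MB b -> inner y (b Psi) = 0) -> rip y (u Psi) <= 0.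
  move=> yP; suff : rip y (u Psi) ^+ 2 <= 0.
    by rewrite le_eqVlt ltNge sqr_ge0 orbF sqrf_eq0 => /eqP ->.
  (* The constant comes from [1 - (1 - e)^2 <= 2 e]. *)
  apply: (le0_eps _ (2 * nm y ^+ 2)) => [|e e0 e1].
    by rewrite mulr_ge0 ?sqr_ge0.
  have [b [Mb bu be]] := uhl _ _ (n1 _ Psi1) (n1 _ uPsi1) mar e e0.
  have b1 : nm (b Psi) = 1 by rewrite unitary_nm.
  set k := inner (b Psi) (u Psi).
  have ke : 1 - e <= complex.Re `|k|.
    have : `|inner (u Psi) (b Psi)| = `|k|.
      by rewrite innerC -/k !normc_def; case: (k) => p q /=; rewrite sqrrN.
    move=> kE; move: be; rewrite kE -(rmorph1 (real_complex R)) -rmorphB.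
    by rewrite lecE => /andP[].
  have := nm_sub_inner_scale _ _ b1 uPsi1; rewrite -/k => dk.
  have yk : rip y (u Psi) = rip y (u Psi - k *: b Psi).
    by rewrite /rip innerBr innerZr (yP _ Mb) mulr0 subr0.
  have h1 : rip y (u Psi) ^+ 2 <= nm y ^+ 2 * nm (u Psi - k *: b Psi) ^+ 2.
    rewrite yk -exprMn -[leLHS]real_normK ?num_real//.
    by rewrite ler_pXn2r ?nnegrE ?mulr_ge0 ?nm_ge0// rip_abs_le.
  rewrite (le_trans h1)// dk mulrA [leRHS]mulrC ler_wpM2l ?sqr_ge0//.
  have : (1 - e) ^+ 2 <= complex.Re `|k| ^+ 2.
    by rewrite ler_pXn2r ?nnegrE ?subr_ge0 ?Re_norm_ge0.
  nra.
have zero (y : H) : (forall b, MB b -> inner y (b Psi) = 0) -> rip y (u Psi) = 0.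
  move=> yP; apply/eqP; rewrite eq_le small//= -oppr_le0 -ripNl small// => b Mb.
  by apply: inner_eq0C; rewrite -scaleN1r innerZr (inner_eq0C _ _ (yP _ Mb)) mulr0.
rewrite innerE zero// -rip_iN zero// => b Mb.
by apply: inner_eq0C; rewrite innerZr (inner_eq0C _ _ (zP _ Mb)) mulr0.
Qed.

(** A hermitian part rescaled to a contraction [g] is the imaginary part of the unitary
    [u = sqrt (1 - g^2) + i g]; [unitary_cyclic] is applied to [u] and to its adjoint. *)
Lemma commutant_cyclic (x : H -> H) (Psi z : H) : commutant MA x ->
  (forall b, MB b -> inner z (b Psi) = 0) -> inner z (x Psi) = 0.
Proof.
suff sa h : selfadjoint h -> commutant MA h ->
    (forall b, MB b -> inner z (b Psi) = 0) -> inner z (h Psi) = 0.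
  move=> /(hermitian_parts hMA) [h [k [[hs Mh] [ks Mk] -> _]]] zP.
  by rewrite innerDr innerZr !sa// mulr0 addr0.
move=> /[dup] hs [/bounded_opP[hl [C C0 hC]] _] Mh zP.
pose g := ((C + 1)^-1)%:C%C \*: h.
have C1 : 0 < C + 1 by lra.
have gs : selfadjoint g by apply: sa_scale.
have Mg : commutant MA g by apply: commutant_scale.
have [|c [cs _ cc cb]] := cosine_exists g 1 gs ler01 (lexx _).
  move=> y; rewrite mul1r nmZ gtr0_norm ?invr_gt0// ler_pdivrMl//.
  by have := hC y; have := nm_ge0 y; nra.
have Mc : commutant MA c by apply: commutant_bicommutes Mg _ cb; case: cs.
have cg y : c (g y) = g (c y) by rewrite -cb//; case: gs.
have ii : 'i%C * 'i%C = -1 :> R[i] by rewrite -expr2 sqr_i.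
have uu := unitary_pair _ _ _ conj_i ii cs gs cg cc.
have Mu := commutant_add hMA _ _ Mc (commutant_scale hMA 'i%C _ Mg).
have uw : adjoint (c \+ 'i%C \*: g) (c \+ (- 'i)%C \*: g).
  apply: adjoint_add; first by case: cs.
  by rewrite -conj_i; apply: adjoint_scale; case: gs.
have := unitary_cyclic _ _ _ (commutant_adjoint hMA _ _ Mu uw)
  (unitary_adjoint _ _ uu uw) zP.
have := unitary_cyclic _ _ _ Mu uu zP.
rewrite /= !innerDr !innerZr => e1 e2.
have : 2 * 'i%C * (C + 1)^-1%:C%C * inner z (h Psi) = 0.
  move: e1 e2; set A := inner z (c Psi); set B := inner z (h Psi).
  set r := (C + 1)^-1%:C%C => e1 e2.
  transitivity ((A + 'i%C * (r * B)) - (A + - 'i%C * (r * B))); first by ring.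
  by rewrite [X in X - _]e1 [X in _ - X]e2 subrr.
move=> /eqP; rewrite !mulf_eq0 pnatr_eq0 /= => /orP[/orP[]|/eqP//].
  by rewrite eq_complex /= oner_eq0 andbF.
by rewrite eq_complex /= invr_eq0 gt_eqF.
Qed.

(** The range of [N] is invariant under [MB], hence under [x] and its adjoint by [commutant_cyclic];
    a subspace invariant under both reduces [x]. *)
Lemma commutant_projection (x N : H -> H) : commutant MA x ->
  projection N -> commutant MB N -> forall t, x (N t) = N (x t).
Proof.
move=> Mx [[[Nl _] NA] NN] /commutantP[_ NM].
have inv y : commutant MA y -> forall t, N (y (N t)) = y (N t).
  move=> My t; apply: inner_inj => s.
  have := commutant_cyclic y (N t) (s - N s) My.
  have sub (r : H) : inner (s - N s) r = inner s r - inner s (N r).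
    by rewrite innerBl NA.
  rewrite sub => h; apply/esym/subr0_eq/h => b Mb.
  by rewrite sub NM// NN subrr.
have [y xy _] := adjoint_ex _ (proj1 ((commutantP x).1 Mx)).
have My := commutant_adjoint hMA _ _ Mx xy.
move=> t; rewrite -[LHS](inv x Mx); apply: inner_inj => s.
by rewrite !NA !xy NA inv.
Qed.


Lemma projection_comp (N P : H -> H) : projection N -> projection P ->
  (forall t, N (P t) = P (N t)) -> projection (N \o P).
Proof.
move=> [Ns NN] [Ps PP] NP; split; first exact: sa_comp.
by move=> t /=; rewrite -[P (N _)]NP PP NN.
Qed.

Lemma projection_one_sub (N : H -> H) : projection N -> projection (one_sub N).
Proof.
move=> [Ns NN]; split; first exact: sa_one_sub.
by move=> t; rewrite !one_subE (linB (sa_linear _ Ns)) NN subrr subr0.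
Qed.

(** Induction on the number of bisections: on the range of [P] the form of [y] lies between [a] and
    [b], and the sign projection of [y - m] at the midpoint [m] splits this range into two pieces
    with intervals of half the length. That projection lies in [commutant MB], so it commutes with
    [x]. *)
Lemma commutator_bound (x y : H -> H) (C : R) (n : nat) :
  commutant MA x -> 0 <= C -> (forall t, nm (x t) <= C * nm t) ->
  selfadjoint y -> commutant MB y ->
  forall (P : H -> H) (a b : R),
    projection P -> commutant MB P -> (forall t, y (P t) = P (y t)) -> a <= b ->
    (forall t, P t = t ->
       a * nm t ^+ 2 <= rip t (y t) /\ rip t (y t) <= b * nm t ^+ 2) ->
  forall t, P t = t -> nm (x (y t) - y (x t)) <= C * ((b - a) / 2 ^+ n) * nm t.
Proof.
move=> Mx C0 xC ys My; have yl := sa_linear _ ys.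
have xl : linear x by move: Mx => /commutantP[[]].
elim: n => [|n IH] P a b Pp MP yP ab Pab t Pt; have Pl := sa_linear _ Pp.1;
  pose m := (a + b) / 2; pose T : H -> H := y \+ (- m)%:C%C \*: idfun;
  have Ts : selfadjoint T by apply: sa_add => //; apply/sa_scale/sa_id.
  have TE s : T s = y s - m%:C%C *: s by rewrite /T /= rmorphN scaleNr.
  have xP := commutant_projection _ _ Mx Pp MP.
  have Tr s : P s = s -> nm (T s) <= (b - a) / 2 * nm s.
    apply: numerical_radius => // [r|r Pr].
      by rewrite !TE (linB Pl) (linZ Pl) yP.
    have [h1 h2] := Pab _ Pr.
    by rewrite TE ripDr ripNr ripZr rip_nm ler_norml /m; apply/andP; split; lra.
  (* The scalar [m] drops out of the commutator, and each of the two remaining terms is at most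
     [C * ((b - a) / 2) * nm t]. *)
  have -> : x (y t) - y (x t) = x (T t) - T (x t).
    by rewrite !TE (linB xl) (linZ xl) opprB addrA subrK.
  have := nm_triangle (x (T t)) (- T (x t)); rewrite nmN.
  have := Tr _ Pt; have := Tr (x t); rewrite -xP Pt => /(_ erefl).
  have := xC (T t); have := xC t => h1 h2 h3 h4 h5.
  have r0 : 0 <= (b - a) / 2 by lra.
  have : C * nm (T t) <= C * ((b - a) / 2 * nm t) by rewrite ler_wpM2l.
  have : (b - a) / 2 * nm (x t) <= (b - a) / 2 * (C * nm t) by rewrite ler_wpM2l.
  by rewrite expr0 divr1; lra.
have TE s : T s = y s - m%:C%C *: s by rewrite /T /= rmorphN scaleNr.
have [N Np [Nneg Npos Nc]] := sign_projection _ Ts.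
have Nl := sa_linear _ Np.1.
have MN : commutant MB N.
  apply: (commutant_bicommutes hMB T); last exact: Nc.
    by apply: commutant_add => //; apply/commutant_scale/commutant_id.
  by case: Np => [[]].
have yN s : y (N s) = N (y s).
  apply: Nc => [|r]; first by case: ys.
  by rewrite !TE (linB yl) (linZ yl).
have PN s : P (N s) = N (P s).
  apply: Nc => [|r]; first by case: Pp => [[]].
  by rewrite !TE (linB Pl) (linZ Pl) yP.
have xN := commutant_projection _ _ Mx Np MN.
have ripT s : rip s (T s) = rip s (y s) - m * nm s ^+ 2.
  by rewrite TE ripDr ripNr ripZr rip_nm.
have half : (b - a) / 2 / 2 ^+ n = (b - a) / 2 ^+ n.+1.
  by rewrite exprS invfM mulrA.
set K := C * _.
have K0 : 0 <= K.
  by rewrite mulr_ge0// divr_ge0 ?exprn_ge0//; lra.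
have b1 : nm (x (y (N t)) - y (x (N t))) <= K * nm (N t).
  rewrite /K -half (_ : (b - a) / 2 = m - a); last by rewrite /m; lra.
  apply: (IH (N \o P)) => [||s||s NPs|].
  - exact: projection_comp.
  - exact: commutant_comp.
  - by rewrite /= yN yP.
  - by rewrite /m; lra.
  - have Ns : N s = s by rewrite -NPs /= Np.2.
    have Ps : P s = s by rewrite -NPs /= PN Pp.2.
    have [h1 h2] := Pab _ Ps; split=> //.
    by have := Nneg _ Ns; rewrite ripT; lra.
  by rewrite /= PN Pt Np.2.
pose N' := one_sub N.
have Np' : projection N' by apply: projection_one_sub.
have PN' s : P (N' s) = N' (P s) by rewrite /N' !one_subE (linB Pl) PN.
have b2 : nm (x (y (N' t)) - y (x (N' t))) <= K * nm (N' t).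
  rewrite /K -half (_ : (b - a) / 2 = b - m); last by rewrite /m; lra.
  apply: (IH (N' \o P)) => [||s||s NPs|].
  - exact: projection_comp.
  - apply: commutant_comp => //.
    by apply: commutant_add => //; [exact: commutant_id|exact: commutant_scale].
  - by rewrite /= /N' !one_subE (linB yl) yN yP.
  - by rewrite /m; lra.
  - have Ns : N s = 0.
      by rewrite -NPs /= /N' one_subE (linB Nl) Np.2 subrr.
    have Ps : P s = s by rewrite -NPs /= PN' Pp.2.
    have [h1 h2] := Pab _ Ps; split=> //.
    by have := Npos _ Ns; rewrite ripT; lra.
  by rewrite /= PN' Pt Np'.2.
have Kn s : 0 <= K * nm s by exact: mulr_ge0 K0 (nm_ge0 s).
(* The commutator preserves the two orthogonal pieces, so by Pythagoras the squared bounds add up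
   without increasing the constant [K]. *)
rewrite -(@ler_pXn2r _ 2)// ?nnegrE ?Kn ?nm_ge0//.
rewrite (pythagoras _ Np) exprMn (pythagoras _ Np t) mulrDr -!exprMn.
have -> : N (x (y t) - y (x t)) = x (y (N t)) - y (x (N t)).
  by rewrite (linB Nl) yN !xN yN.
have -> : x (y t) - y (x t) - (x (y (N t)) - y (x (N t))) =
    x (y (N' t)) - y (x (N' t)).
  by rewrite /N' one_subE !(linB xl, linB yl); apply: vecP => w; rewrite !ripE; ring.
rewrite -(one_subE N t) -/N'.
by apply: lerD; rewrite ler_pXn2r ?nnegrE ?Kn ?nm_ge0.
Qed.

Lemma uhlmann_commute (x y : H -> H) : commutant MA x -> commutant MB y ->
  forall t, x (y t) = y (x t).
Proof.
move=> Mx; have /bounded_opP[xl [C C0 xC]] : bounded_op x by case/commutantP: Mx.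
suff sa h : selfadjoint h -> commutant MB h -> forall t, x (h t) = h (x t).
  move=> /(hermitian_parts hMB) [h [k [[hs Mh] [ks Mk] hk _]]] t.
  by rewrite !hk (linD xl) (linZ xl) (sa h)// (sa k).
move=> /[dup] hs [/bounded_opP[hl [D D0 hD]] _] Mh t; apply/subr0_eq/nm_eq0.
(* The bisection starts from the whole space and the interval from [- D] to [D]. *)
have bound n : nm (x (h t) - h (x t)) <= C * ((D - - D) / 2 ^+ n) * nm t.
  apply: (commutator_bound x h C n Mx C0 xC hs Mh idfun) => //.
  - by split=> //; exact: sa_id.
  - exact: commutant_id.
  - by lra.
  move=> s _; have := rip_abs_le s (h s); rewrite ler_norml => /andP[h1 h2].
  have : nm s * nm (h s) <= nm s * (D * nm s) by rewrite ler_wpM2l ?nm_ge0.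
  by split; lra.
apply/eqP; rewrite eq_le nm_ge0 andbT.
apply: (le0_eps _ (C * (D - - D) * nm t)).
  by rewrite !mulr_ge0 ?nm_ge0//; lra.
move=> e e0 _.
have ei : 0 <= e^-1 by rewrite invr_ge0 ltW.
pose n := Num.bound e^-1.
have en : (2 ^+ n)^-1 <= e.
  rewrite invf_ple ?posrE ?exprn_gt0// ltW// (lt_trans (archi_boundP ei))//.
  by rewrite -natrX ltr_nat ltn_expl.
rewrite (le_trans (bound n))//.
have -> : C * ((D - - D) / 2 ^+ n) * nm t = (2 ^+ n)^-1 * (C * (D - - D) * nm t).
  by ring.
by rewrite ler_wpM2r// !mulr_ge0 ?nm_ge0//; lra.
Qed.

Lemma uhlmann_haag : commuting MA MB -> haag_duality MA MB.
Proof.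
move=> hcomm; apply/seteqP; split=> x.
  move=> Mx; split; first exact: (vna_bounded hMB).
  by move=> a Ma; apply/esym/hcomm.
(* Since [MB] is its own bicommutant, it suffices that [x] commutes with [commutant MB]. *)
move=> Mx; rewrite (vna_bicommutant hMB); apply/commutantP; split=> [|y My].
  by case/commutantP: Mx.
exact: uhlmann_commute.
Qed.

End UhlmannHaag.

Theorem theorem2 (R : realType) (H : hilbertType R) (MA MB : set (H -> H))
    (hMA : von_neumann_algebra MA) (hMB : von_neumann_algebra MB)
    (hcomm : commuting MA MB) :
  (uhlmann_property MA MB <-> haag_duality MA MB) /\
  (haag_duality MA MB ->
   forall Psi Phi : H, `|Psi| = 1 -> `|Phi| = 1 ->
     same_marginal MA Psi Phi ->
     exists v, [/\ MB v, partial_isometry v & v Psi = Phi]).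
Proof.
split; first split.
- by move=> uhl; exact: uhlmann_haag hMA hMB uhl hcomm.
- by move=> ->; exact: haag_uhlmann.
move=> -> Psi Phi _ _ mar.
by have [v [Mv vp vPsi _]] := marginal_partial_isometry hMA Psi Phi mar; exists v.
Qed.
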